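(* Under the GARCH-2F model with Assumption 1, suppose $\rho(\boldsymbol{B})<1$, $\rho(\boldsymbol{\beta})<1$, $\det(\boldsymbol{\alpha})\neq0$, and $$\varphi=\mathbb{E}\big[\|\boldsymbol{B}+\boldsymbol{b}(\boldsymbol{W}_t)\|\big]<1.$$ Then the process $\{(R_t,\boldsymbol{v}_t)\}$ is geometrically ergodic; in particular, if initialized from its invariant distribution, $\{R_t\}$ is strictly stationary and geometrically ergodic.
   Context: Model (GARCH-2F): $Z_{1,t},Z_{2,t}$ i.i.d. $N(0,1)$ in $t$, mutually independent. $R_t=r+\lambda(v_{1,t}+v_{2,t})+\sqrt{v_{1,t}}Z_{1,t}+\sqrt{v_{2,t}}Z_{2,t}$ with constants $r,\lambda$; $\boldsymbol{W}_t=(W_{1,t},W_{2,t})^T=(Z_{1,t-1},Z_{2,t-1})^T$; $\boldsymbol{v}_t=(v_{1,t},v_{2,t})^T=\boldsymbol{\omega}+\boldsymbol{\beta}\boldsymbol{v}_{t-1}+\boldsymbol{\alpha}\big[(W_{1,t}-\gamma_1\sqrt{v_{1,t-1}})^2,(W_{2,t}-\gamma_2\sqrt{v_{2,t-1}})^2\big]^T$, with $\boldsymbol{\omega}=(\omega_1,\omega_2)^T$, $\boldsymbol{\beta}=(\beta_{ij})$, $\boldsymbol{\alpha}=(\alpha_{ij})$ ($2\times 2$), $\gamma_1,\gamma_2\in\mathbb{R}$. Assumption 1: $\omega_i>0$, $\beta_{ij}\ge0$, $\alpha_{ij}\ge0$, $\alpha_{11}+\alpha_{12}>0$, $\alpha_{21}+\alpha_{22}>0$,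 $\beta_{11}+\beta_{12}>0$, $\beta_{21}+\beta_{22}>0$. State space of $\boldsymbol{v}_t$ is $\mathcal{D}=[\omega_1,\infty)\times[\omega_2,\infty)$. $\boldsymbol{B}$ has entries $B_{ij}=\beta_{ij}+\alpha_{ij}\gamma_j^2$; $\boldsymbol{b}(\boldsymbol{W}_t)$ is the $2\times2$ matrix with entries $b_{ij}=\alpha_{ij}W_{j,t}^2\mathbf{1}_{(\gamma_jW_{j,t}<0)}$. $\rho$ is spectral radius; $\|\cdot\|$ the Euclidean / induced $L_2$ norm. A Markov process with transition kernels $P^n$ is geometrically ergodic if there exist a probability measure $\pi$, a constant $0<c<1$ and a $\pi$-integrable nonnegative measurable $Q$ with $\|P^n(\boldsymbol{x},\cdot)-\pi(\cdot)\|_{TV}\le c^nQ(\boldsymbol{x})$ for all $n\ge0$ and all states $\boldsymbol{x}$, where $\|\mu\|_{TV}=\sup_{|g|\le1}|\mu(g)|$. *)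

(* Defs.v *)
From HB Require Import structures.
From mathcomp Require Import all_boot all_order all_algebra.
From mathcomp Require Import all_classical all_reals all_analysis.
From mathcomp Require complex.
Import complex.ComplexField.
Set Implicit Arguments. Unset Strict Implicit. Unset Printing Implicit Defensive.
Import Order.TTheory GRing.Theory Num.Theory.
Import numFieldNormedType.Exports.
Local Open Scope classical_set_scope.
Local Open Scope ring_scope.

Section Defs.
Context {R : realType}.

Definition cmod (z : complex.complex R) : R :=
  Num.sqrt (complex.Re z ^+ 2 + complex.Im z ^+ 2).

Definition spectral_radius (M : 'M[R]_2) : R :=
  sup [set cmod z | z in [set z : complex.complex R |
        root (char_poly (map_mx (fun x : R => complex.Complex x 0) M)) z]].

Definition enorm (x : 'cV[R]_2) : R := Num.sqrt (\sum_i x i 0 ^+ 2).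

Definition opnorm (A : 'M[R]_2) : R :=
  sup [set enorm (A *m x) | x in [set x : 'cV[R]_2 | enorm x = 1]].

(** ** GARCH-2F parameters (indices 0,1 stand for 1,2) *)

Definition assumption1 (omega : 'I_2 -> R) (beta alpha : 'M[R]_2) : Prop :=
  (forall i, 0 < omega i) /\
  (forall i j, 0 <= beta i j) /\ (forall i j, 0 <= alpha i j) /\
  (forall i, 0 < alpha i 0 + alpha i 1) /\
  (forall i, 0 < beta i 0 + beta i 1).

Definition Bmat (beta alpha : 'M[R]_2) (gamma : 'I_2 -> R) : 'M[R]_2 :=
  \matrix_(i, j) (beta i j + alpha i j * gamma j ^+ 2).

Definition bmat (alpha : 'M[R]_2) (gamma : 'I_2 -> R) (W : 'I_2 -> R) : 'M[R]_2 :=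
  \matrix_(i, j) (alpha i j * W j ^+ 2 * (if gamma j * W j < 0 then 1 else 0)).

Definition stdN : set (measurableTypeR R) -> \bar R := normal_prob 0 1.

Definition varphi (beta alpha : 'M[R]_2) (gamma : 'I_2 -> R) : \bar R :=
  (\int[stdN]_w1 \int[stdN]_w2
     (opnorm (Bmat beta alpha gamma +
              bmat alpha gamma (fun j => if j == ord0 then w1 else w2)))%:E)%E.

(** ** The Markov chain X_t = (R_t, (v_{1,t}, v_{2,t})) *)

Definition state := (R * (R * R))%type.

Definition statespace (omega : 'I_2 -> R) : set state :=
  [set x | omega ord0 <= x.2.1 /\ omega (lift ord0 ord0) <= x.2.2].

(* One transition.  From x = (R_t, v_t) and noise (u, z1', z2') of three
   independent N(0,1) variables:
   - Z_t = (Z_{1,t}, Z_{2,t}) is drawn from its conditional law given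
     (R_t, v_t), i.e. N(0,I_2) conditioned on
     sqrt v1 Z1 + sqrt v2 Z2 = R_t - r - lambda (v1 + v2); explicitly
     Z = a c / s + a_perp u / sqrt s, a = (sqrt v1, sqrt v2), s = v1 + v2,
     a_perp = (-sqrt v2, sqrt v1), c = R_t - r - lambda s;
   - v_{t+1} = omega + beta v_t
        + alpha [(Z_{1,t} - gamma1 sqrt v1)^2, (Z_{2,t} - gamma2 sqrt v2)^2]
     (recall W_{t+1} = Z_t);
   - R_{t+1} = r + lambda (v1' + v2') + sqrt v1' z1' + sqrt v2' z2'. *)
Definition garch_step (r lam : R) (omega : 'I_2 -> R) (beta alpha : 'M[R]_2)
    (gamma : 'I_2 -> R) (x : state) (w : R * (R * R)) : state :=
  let v1 := x.2.1 in let v2 := x.2.2 in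
  let s := v1 + v2 in
  let c := x.1 - r - lam * s in
  let u := w.1 in
  let Z1 := Num.sqrt v1 * c / s - Num.sqrt v2 * u / Num.sqrt s in
  let Z2 := Num.sqrt v2 * c / s + Num.sqrt v1 * u / Num.sqrt s in
  let i1 := ord0 : 'I_2 in let i2 := lift ord0 ord0 : 'I_2 in
  let e1 := (Z1 - gamma i1 * Num.sqrt v1) ^+ 2 in
  let e2 := (Z2 - gamma i2 * Num.sqrt v2) ^+ 2 in
  let v1' := omega i1 + beta i1 i1 * v1 + beta i1 i2 * v2
             + alpha i1 i1 * e1 + alpha i1 i2 * e2 in
  let v2' := omega i2 + beta i2 i1 * v1 + beta i2 i2 * v2
             + alpha i2 i1 * e1 + alpha i2 i2 * e2 in
  (r + lam * (v1' + v2') + Num.sqrt v1' * w.2.1 + Num.sqrt v2' * w.2.2,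
   (v1', v2')).

Definition Enoise (f : R * (R * R) -> R) : R :=
  fine (\int[stdN]_u \int[stdN]_z1 \int[stdN]_z2 (f (u, (z1, z2)))%:E)%E.

(* P^n g (x) = integral of g against the n-step kernel P^n(x, .) *)
Fixpoint Pn (step : state -> R * (R * R) -> state) (n : nat)
    (g : state -> R) (x : state) : R :=
  match n with
  | 0 => g x
  | n'.+1 => Enoise (fun w => Pn step n' g (step x w))
  end.

Definition pint (pi : probability state R) (g : state -> R) : R :=
  fine (\int[pi]_y (g y)%:E)%E.

Definition tv_dist (step : state -> R * (R * R) -> state) (n : nat) (x : state)
    (pi : probability state R) : R :=
  sup [set `|Pn step n g x - pint pi g| | g in
        [set g : state -> R | measurable_fun setT g /\ forall y, `|g y| <= 1]].

Definition geometrically_ergodic (step : state -> R * (R * R) -> state)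
    (S : set state) (pi : probability state R) : Prop :=
  pi S = 1%E /\
  exists (c : R) (Q : state -> R),
    0 < c < 1 /\ measurable_fun setT Q /\ (forall y, 0 <= Q y) /\
    pi.-integrable setT (fun y => (Q y)%:E) /\
    forall n x, S x -> tv_dist step n x pi <= c ^+ n * Q x.

Definition pi_invariant (step : state -> R * (R * R) -> state)
    (pi : probability state R) : Prop :=
  forall g : state -> R, measurable_fun setT g -> (forall y, `|g y| <= 1) ->
    pint pi (Pn step 1 g) = pint pi g.

End Defs.

(* Main.v *)
Require Import Defs.
From HB Require Import structures.
From mathcomp Require Import all_boot all_order all_algebra.
From mathcomp Require Import all_classical all_reals all_analysis.
From mathcomp Require Import measurable_realfun.
From mathcomp Require complex.
From mathcomp Require Import ring lra zify.
Import complex.ComplexField.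
Import Order.TTheory GRing.Theory Num.Theory.
Import numFieldNormedType.Exports.
Set Implicit Arguments.
Unset Strict Implicit.
Unset Printing Implicit Defensive.
Local Open Scope classical_set_scope.
Local Open Scope ring_scope.

(** Write [P] for the transition operator of [(R_t, v_t)].  Drawing [v_{t+1}]
    given [(R_t, v_t)] and then [R_{t+1}] given [v_{t+1}] factors it as
    [P = K H], and rotation invariance of the Gaussian law identifies [T = H K]
    with the transition operator of [v_t] driven by two independent normal
    variables; since [P^{n+1} = K T^n H], it is enough to study [T].

    Drift: [E [v_{t+1} | v_t] = omega + alpha 1 + B v_t], and [rho(B) < 1] with
    [B >= 0] gives a positive linear Lyapunov function [V v = p . v].
    Minorization: [v_{t+1} = alpha (e + q)] where [alpha q = omega + beta v_t]
    and the coordinates of [e] are squares of shifted normal variables; for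
    [v_t] in a bounded set the law of [e + q] dominates a fixed multiple of the
    uniform law on a far enough square, so that of [v_{t+1}] dominates a fixed
    multiple of its image under [alpha].

    These two facts make [T] a contraction for the oscillation seminorm
    weighted by [2 + b V(v) + b V(w)] (Hairer and Mattingly's proof of Harris'
    theorem).  Hence [P^n g (x)] converges geometrically, uniformly in
    [|g| <= 1]; the limit functional is sigma-continuous and is therefore the
    integral against a probability measure. *)

(** * Means and Markov operators on bounded measurable functions *)

Section bounded_measurable.
Context {R : realType} {d : measure_display} {X : measurableType d}.
Implicit Types f g : X -> R.

(** Given [(R_t, v_t)] only one Gaussian coordinate of [Z_t] stays free, so one step of the pair
    moves [v_{t+1}] along a curve, and its mean depends on [R_t]. Neither a minorization nor a drift
    in [v_t] alone is available there. Under [T = H K] the return is averaged out and both Gaussian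
    coordinates are free again.

    Kernels are represented by their action on bounded measurable functions, in keeping with [Pn],
    which is built from iterated integrals. The price is that Lyapunov functions are unbounded:
    moment bounds are stated for their truncations and transferred to a bounded [f] by truncating at
    a level that depends on the bound of [f]. The limit law is accordingly found through the numbers
    [P^n g x0], not through a limit of measures.

    The estimates are wanted at every point, while the recursion is meaningful only on the state
    space. Volatilities are therefore projected onto it, and the projected chain is compared with
    the given one on the state space. *)

Definition bmeas f : Prop :=
  measurable_fun setT f /\ exists M, forall x, `|f x| <= M.

Lemma bmeas_cst (c : R) : bmeas (fun=> c).
Proof. by split; [exact: measurable_cst|exists `|c|]. Qed.

Lemma bmeasD f g : bmeas f -> bmeas g -> bmeas (fun x => f x + g x).
Proof.
move=> [mf [M fM]] [mg [N gN]]; split; first exact: measurable_funD.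
by exists (M + N) => x; rewrite (le_trans (ler_normD _ _))// lerD.
Qed.

Lemma bmeasZ (c : R) f : bmeas f -> bmeas (fun x => c * f x).
Proof.
move=> [mf [M fM]]; split; first exact: measurable_funM.
by exists (`|c| * M) => x; rewrite normrM ler_wpM2l.
Qed.

Lemma bmeas_lin (c p q : R) f g : bmeas f -> bmeas g ->
  bmeas (fun x => c + p * f x + q * g x).
Proof.
move=> bf bg; apply: bmeasD; last exact: bmeasZ.
by apply: bmeasD; [exact: bmeas_cst|exact: bmeasZ].
Qed.

Lemma bmeas_indic (A : set X) : measurable A -> bmeas (\1_A : X -> R).
Proof.
move=> mA; split; first exact: measurable_indic.
by exists 1 => x; rewrite indicE ger0_norm// lern1 leq_b1.
Qed.

Lemma bmeas_trunc f (M : R) : measurable_fun setT f -> (forall x, 0 <= f x) ->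
  0 <= M -> bmeas (fun x => Num.min (f x) M).
Proof.
move=> mf f0 M0; split.
  by apply: measurable_minr => //; exact: measurable_cst.
by exists M => x; rewrite ger0_norm ?ge_min ?lexx ?orbT// le_min f0.
Qed.

Lemma bmeas_ub f : bmeas f -> exists2 M, 0 <= M & forall x, `|f x| <= M.
Proof.
move=> [_ [M fM]]; exists `|M| => // x.
by rewrite (le_trans (fM x))// ler_norm.
Qed.

(** An expectation, reduced to properties that pass to compositions and to the final limit. The last
    one is bounded convergence, with no monotonicity of the sequence; on indicators it becomes
    sigma-additivity. *)
Record mean (m : (X -> R) -> R) : Prop := Mean {
  mean_cst : forall c, m (fun=> c) = c ;
  meanD : forall f g, bmeas f -> bmeas g ->
    m (fun x => f x + g x) = m f + m g ;
  meanZ : forall c f, bmeas f -> m (fun x => c * f x) = c * m f ;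
  mean_le : forall f g, bmeas f -> bmeas g ->
    (forall x, f x <= g x) -> m f <= m g ;
  mean_cvg0 : forall u : nat -> X -> R, (forall n, bmeas (u n)) ->
    (forall n x, 0 <= u n x <= 1) ->
    (forall x, u n x @[n --> \oo] --> (0 : R)) ->
    m (u n) @[n --> \oo] --> (0 : R) }.

Lemma mean_lin m (c p q : R) f g : mean m -> bmeas f -> bmeas g ->
  m (fun x => c + p * f x + q * g x) = c + p * m f + q * m g.
Proof.
move=> mm bf bg; rewrite (meanD mm)//; last 2 first.
- by apply: bmeasD; [exact: bmeas_cst|exact: bmeasZ].
- exact: bmeasZ.
rewrite (meanD mm) ?(mean_cst mm) ?(meanZ mm)//; first exact: bmeas_cst.
exact: bmeasZ.
Qed.

Lemma mean_ge0 m f : mean m -> bmeas f -> (forall x, 0 <= f x) -> 0 <= m f.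
Proof.
move=> mm bf f0; rewrite -(mean_cst mm 0); apply: (mean_le mm) => //.
exact: bmeas_cst.
Qed.

Lemma mean_norm_le m f M : mean m -> bmeas f -> (forall x, `|f x| <= M) ->
  `|m f| <= M.
Proof.
move=> mm bf fM; rewrite ler_norml; apply/andP; split.
  rewrite -[leLHS](mean_cst mm); apply: (mean_le mm) => //.
    exact: bmeas_cst.
  by move=> x; have := fM x; rewrite ler_norml => /andP[].
rewrite -[leRHS](mean_cst mm); apply: (mean_le mm) => //.
  exact: bmeas_cst.
by move=> x; have := fM x; rewrite ler_norml => /andP[].
Qed.

(* Case [a = 0] is the crude bound; for [a > 0] the common part [a * nu] of
   [m] and [n] cancels, which is the source of the contraction. *)
Lemma mean_oscillation m n nu (a A b : R) f U :
  mean m -> mean n -> mean nu -> 0 <= a < 1 -> 0 <= A -> 0 <= b ->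
  (forall g, bmeas g -> (forall x, 0 <= g x) -> a * nu g <= m g) ->
  (forall g, bmeas g -> (forall x, 0 <= g x) -> a * nu g <= n g) ->
  bmeas f -> bmeas U -> (forall x, 0 <= U x) ->
  (forall x y, f x - f y <= A * (2 + b * U x + b * U y)) ->
  m f - n f <= A * (2 * (1 - a) + b * m U + b * n U).
Proof.
move=> mm mn mnu /andP[a0 a1] A0 b0 num nun bf bU U0 fU.
(* [m - a * nu] and [n - a * nu] are positive functionals of mass [1 - a]. The hypothesis is
   integrated against the first in [x] with [y] fixed, then against the second in [y]; [D] is what
   the first integration makes of the terms in [x]. *)
set D := A * b * (m U - a * nu U) - (m f - a * nu f).
have D_ge y : 0 <= (1 - a) * A * 2 + D + ((1 - a) * A * b) * U y + (1 - a) * f y.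
  have := num (fun x => (A * (2 + b * U y) + f y) + (A * b) * U x + (-1) * f x).
  rewrite !mean_lin// => /(_ (bmeas_lin _ _ _ bU bf)).
  move=> H; rewrite /D; suff: forall x, 0 <= A * (2 + b * U y) + f y + A * b * U x + -1 * f x.
    by move=> /H; lra.
  by move=> x; have := fU x y; lra.
have := nun _ (bmeas_lin ((1 - a) * A * 2 + D) ((1 - a) * A * b) (1 - a) bU bf) D_ge.
rewrite !mean_lin// => Dn.
have a1' : 0 < 1 - a by rewrite subr_gt0.
have : 0 <= (1 - a) * ((1 - a) * A * 2 + D + A * b * (n U - a * nu U) + (n f - a * nu f)).
  by lra.
rewrite pmulr_rge0// /D => {}Dn.
(* The two [nu f] cancel; the [nu U] have a favourable sign and are dropped. *)
have nuU : 0 <= A * b * a * nu U by rewrite !mulr_ge0// mean_ge0.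
lra.
Qed.

End bounded_measurable.

Section markov_operator.
Context {R : realType}.

Definition markov_op {d1 d2 : measure_display} {Y : measurableType d1}
    {X : measurableType d2} (K : (Y -> R) -> X -> R) : Prop :=
  (forall f, bmeas f -> bmeas (K f)) /\ (forall x, mean (fun f => K f x)).

Lemma markov_op_id {d} {X : measurableType d} :
  markov_op (fun f : X -> R => f).
Proof. by split=> // x; split => //. Qed.

Lemma markov_op_comp {d1 d2 d3} {Z : measurableType d1} {Y : measurableType d2}
    {X : measurableType d3} (K : (Y -> R) -> X -> R) (H : (Z -> R) -> Y -> R) :
  markov_op K -> markov_op H -> markov_op (fun f => K (H f)).
Proof.
move=> [bK mK] [bH mH]; split => [f bf|x]; first exact/bK/bH.
split.
- move=> c; rewrite (_ : H _ = fun=> c); first exact: mean_cst (mK x) c.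
  by apply/funext => y; exact: mean_cst (mH y) c.
- move=> f g bf bg; rewrite -(meanD (mK x)); [|exact: bH|exact: bH].
  by congr (K _ x); apply/funext => y; exact: meanD (mH y) _ _ _ _.
- move=> c f bf; rewrite -(meanZ (mK x)); last exact: bH.
  by congr (K _ x); apply/funext => y; exact: meanZ (mH y) _ _ _.
- move=> f g bf bg fg; apply: (mean_le (mK x)); [exact: bH|exact: bH|].
  by move=> y; exact: mean_le (mH y) _ _ _ _ _.
- move=> u bu u01 u0; apply: (mean_cvg0 (mK x)) => [n|n y|y].
  + exact: bH.
  + apply/andP; split.
      by apply: (mean_ge0 (mH y)) => // z; have /andP[] := u01 n z.
    rewrite -(mean_cst (mH y) 1); apply: (mean_le (mH y)) => //.
      exact: bmeas_cst.
    by move=> z; have /andP[] := u01 n z.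
  + exact: (mean_cvg0 (mH y)).
Qed.

Lemma markov_op_iter {d} {X : measurableType d} (T : (X -> R) -> X -> R) n :
  markov_op T -> markov_op (iter n T).
Proof.
move=> mT; elim: n => [|n IH]; first exact: markov_op_id.
exact: (markov_op_comp mT IH).
Qed.

End markov_operator.

(** * Harris' theorem *)

Section truncated_moment.
Context {R : realType} {d : measure_display} {X : measurableType d}.
Implicit Types (m n : (X -> R) -> R) (V f : X -> R).

(* [mean]s are only meant for bounded functions, so the mean of an unbounded
   [V] is bounded through its truncations. *)
Definition mean_ub m V (s : R) : Prop :=
  forall M, 0 <= M -> m (fun x => Num.min (V x) M) <= s.

Lemma mean_le_affine m V s (a b : R) f : mean m -> measurable_fun setT V ->
  (forall x, 0 <= V x) -> mean_ub m V s -> bmeas f -> 0 <= b ->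
  (forall x, f x <= a + b * V x) -> m f <= a + b * s.
Proof.
move=> mm mV V0 mVs bf; rewrite le_eqVlt => /predU1P[<- fa|b0 fa].
  rewrite mul0r addr0 -[leRHS](mean_cst mm); apply: (mean_le mm) => //.
    exact: bmeas_cst.
  by move=> x; rewrite (le_trans (fa x))// mul0r addr0.
have [B B0 fB] := bmeas_ub bf.
(* Where [V x] exceeds this level, the truncated bound [a + b * M] is at least [B], hence still
   above [f x]. *)
pose M := (B + `|a|) / b.
have M0 : 0 <= M by rewrite divr_ge0 ?addr_ge0// ltW.
have bM : b * M = B + `|a| by rewrite /M mulrCA divff ?gt_eqF// mulr1.
have bVM := bmeas_trunc mV V0 M0.
apply: (@le_trans _ _ (m (fun x => a + b * Num.min (V x) M + 0 * f x))).
  apply: (mean_le mm) => //; first exact: bmeas_lin.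
  move=> x; rewrite mul0r addr0 /Num.min; case: ifPn => // _; rewrite bM.
  have := fB x; rewrite ler_norml => /andP[_ fxB].
  by have := ler_norm (- a); rewrite normrN; lra.
by rewrite mean_lin// mul0r addr0 lerD2l ler_wpM2l ?(ltW b0)// mVs.
Qed.

Lemma mean_oscillation_ub m n nu (a A b s t : R) f V :
  mean m -> mean n -> mean nu -> 0 <= a < 1 -> 0 <= A -> 0 < b ->
  (forall g, bmeas g -> (forall x, 0 <= g x) -> a * nu g <= m g) ->
  (forall g, bmeas g -> (forall x, 0 <= g x) -> a * nu g <= n g) ->
  bmeas f -> measurable_fun setT V -> (forall x, 0 <= V x) ->
  mean_ub m V s -> mean_ub n V t ->
  (forall x y, f x - f y <= A * (2 + b * V x + b * V y)) ->
  m f - n f <= A * (2 * (1 - a) + b * s + b * t).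
Proof.
move=> mm mn mnu a01 + b0 am an bf mV V0 mVs nVt; rewrite le_eqVlt.
move=> /predU1P[<-|A0] fV.
  have := @mean_oscillation R d X m n nu a 0 0 f (fun=> 0) mm mn mnu a01
    (lexx _) (lexx _) am an bf (bmeas_cst 0) (fun=> lexx _).
  rewrite !mul0r; apply => x y; have := fV x y; lra.
have [B B0 fB] := bmeas_ub bf.
(* [f x - f y] is at most [2 * B = A * b * M], so truncating [V] at [M] preserves the oscillation
   hypothesis. The division is why [A = 0] is treated apart. *)
pose M := (2 * B) / (A * b).
have Ab0 : 0 < A * b by rewrite mulr_gt0.
have M0 : 0 <= M by rewrite divr_ge0 ?mulr_ge0// ltW.
have AbM : A * b * M = 2 * B by rewrite /M mulrCA divff ?gt_eqF// mulr1.
have VM0 x : 0 <= Num.min (V x) M by rewrite le_min V0.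
apply: (@le_trans _ _ (A * (2 * (1 - a) + b * m (fun x => Num.min (V x) M)
    + b * n (fun x => Num.min (V x) M)))).
  apply: (mean_oscillation mm mn mnu) => //; [exact: ltW|exact: ltW|exact: bmeas_trunc|].
  move=> x y; have := fV x y; have := fB x; have := fB y.
  rewrite !ler_norml => /andP[y1 y2] /andP[x1 x2] H.
  have := mulr_ge0 (ltW Ab0) (VM0 x); have := mulr_ge0 (ltW Ab0) (VM0 y).
  have A0' := ltW A0.
  rewrite /Num.min; case: ifPn => _; case: ifPn => _; lra.
rewrite ler_pM2l//.
have := ler_wpM2l (ltW b0) (mVs M M0); have := ler_wpM2l (ltW b0) (nVt M M0).
lra.
Qed.

End truncated_moment.

Section harris.
Context {R : realType} {d : measure_display} {Y : measurableType d}.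
Variables (T : (Y -> R) -> Y -> R) (V : Y -> R) (gam C al : R).
Variable nu : (Y -> R) -> R.
Hypothesis mT : markov_op T.
Hypothesis mnu : mean nu.
Hypothesis mV : measurable_fun setT V.
Hypothesis V0 : forall y, 0 <= V y.
Hypothesis gam01 : 0 < gam < 1.
Hypothesis C0 : 0 < C.
Hypothesis al01 : 0 < al < 1.
Hypothesis drift : forall y, mean_ub (fun f => T f y) V (gam * V y + C).
(** The factor 4 is set by the complementary case: once [V x + V y] exceeds this level, the two
    constants [C] of the drift use up at most half of the gain [(1 - gam) * (V x + V y)]. *)
Hypothesis minor : forall y, V y <= 4 * C / (1 - gam) ->
  forall f, bmeas f -> (forall x, 0 <= f x) -> al * nu f <= T f y.

Definition harris_rate := 1 - al * (1 - gam) / 4.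
(** Solves [2 * b * C = al]: the drift constants at the two points then cost half of the [2 * al]
    gained by coupling. *)
Definition harris_weight := al / (2 * C).

Lemma harris_rate01 : 0 < harris_rate < 1.
Proof. by rewrite /harris_rate; move: gam01 al01 => /andP[? ?] /andP[? ?]; nra. Qed.

Lemma harris_weight_gt0 : 0 < harris_weight.
Proof. by rewrite divr_gt0 ?mulr_gt0//; case/andP: al01. Qed.

(** If [V x + V y] is small, both points admit the minorization and coupling shrinks the constant 2
    of the weight by more than the drift constants restore. If it is large, the drift alone
    contracts, with [nu] taken with mass 0. [harris_rate] is close enough to 1 to serve both
    cases. *)
Lemma harris_contraction (A : R) f : bmeas f -> 0 <= A ->
  (forall x y, f x - f y <= A * (2 + harris_weight * V x + harris_weight * V y)) ->
  forall x y, T f x - T f y <=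
    harris_rate * A * (2 + harris_weight * V x + harris_weight * V y).
Proof.
move=> bf A0 fV x y.
have b0 := harris_weight_gt0; set b := harris_weight in b0 fV *.
have bC : 2 * b * C = al by rewrite /b /harris_weight; field; rewrite gt_eqF.
have [g0 g1] := andP gam01; have [a0 a1] := andP al01.
have [_ mTx] := mT.
rewrite [_ * A]mulrC -mulrA.
have bVx : 0 <= b * (V x + V y) by rewrite mulr_ge0 ?addr_ge0 ?(ltW b0).
have [Vxy|Vxy] := leP (V x + V y) (4 * C / (1 - gam)).
  have mx : V x <= 4 * C / (1 - gam) by have := V0 y; lra.
  have my : V y <= 4 * C / (1 - gam) by have := V0 x; lra.
  apply: (le_trans (mean_oscillation_ub (mTx x) (mTx y) mnu _ A0 b0
    (minor mx) (minor my) bf mV V0 (@drift x) (@drift y) fV)).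
    by rewrite a1 ltW.
  rewrite ler_wpM2l// /harris_rate.
  have h1 : 0 <= (1 - gam) * (1 - al / 4) * (b * (V x + V y)).
    by rewrite mulr_ge0// mulr_ge0//; lra.
  have h2 : 0 <= al * (1 + gam) by rewrite mulr_ge0//; lra.
  lra.
have zmin z g : bmeas g -> (forall x, 0 <= g x) -> 0 * nu g <= T g z.
  by move=> bg g0'; rewrite mul0r; exact: mean_ge0 (mTx z) bg g0'.
apply: (le_trans (mean_oscillation_ub (mTx x) (mTx y) mnu _ A0 b0
  (zmin x) (zmin y) bf mV V0 (@drift x) (@drift y) fV)).
  by rewrite lexx ltr01.
rewrite ler_wpM2l// /harris_rate.
have h1 : 2 * al <= (1 - gam) * (b * (V x + V y)).
  have -> : 2 * al = (1 - gam) * (b * (4 * C / (1 - gam))).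
    by rewrite -bC; field; lra.
  by rewrite ler_wpM2l ?ler_wpM2l ?(ltW b0) ?(ltW Vxy)//; lra.
have h2 : 0 <= (1 - al / 4) * ((1 - gam) * (b * (V x + V y)) - 2 * al).
  by rewrite mulr_ge0//; lra.
have h3 : 0 <= al * ((1 - al) / 2 + gam / 2) by rewrite mulr_ge0//; lra.
lra.
Qed.

Lemma harris_iter n f : bmeas f -> (forall x, `|f x| <= 1) ->
  forall x y, iter n T f x - iter n T f y <=
    harris_rate ^+ n * (2 + harris_weight * V x + harris_weight * V y).
Proof.
move=> bf f1; elim: n => [x y|n IH x y] /=.
  rewrite expr0 mul1r; have := f1 x; have := f1 y.
  rewrite !ler_norml => /andP[? ?] /andP[? ?].
  have := mulr_ge0 (ltW harris_weight_gt0) (V0 x).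
  have := mulr_ge0 (ltW harris_weight_gt0) (V0 y).
  lra.
rewrite exprS; apply: harris_contraction => //.
  by have [+ _] := markov_op_iter n mT; apply.
by rewrite exprn_ge0// ltW//; have /andP[] := harris_rate01.
Qed.

Lemma drift_iter k y :
  mean_ub (fun f => iter k T f y) V (V y + C / (1 - gam)).
Proof.
have [g0 g1] := andP gam01.
have C'0 : 0 <= C / (1 - gam) by rewrite divr_ge0 ?subr_ge0 ?ltW.
(* The form that iterates is the convex combination, with weights [1 - gam ^+ k] and [gam ^+ k], of
   the fixed point of [t -> gam * t + C] and of [V y]. *)
suff : mean_ub (fun f => iter k T f y) V
    (C / (1 - gam) * (1 - gam ^+ k) + gam ^+ k * V y).
  move=> H M M0; rewrite (le_trans (H M M0))//.
  have gk1 : gam ^+ k <= 1 by rewrite exprn_ile1// ltW.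
  have gk0 : 0 <= gam ^+ k by rewrite exprn_ge0// ltW.
  have := mulr_ge0 C'0 gk0; have := V0 y; have := ler_wpM2r (V0 y) gk1.
  by lra.
elim: k y => [|k IH] y M M0 /=.
  by rewrite expr0 subrr mulr0 add0r mul1r ge_min lexx.
have bVM := bmeas_trunc mV V0 M0.
have [bTk _] := markov_op_iter k mT.
apply: (le_trans (mean_le_affine (mT.2 y) mV V0 (@drift y) (bTk _ bVM) _
  (fun z => IH z M M0))).
  by rewrite exprn_ge0// ltW.
by rewrite exprSr le_eqVlt; apply/orP; left; apply/eqP; field; lra.
Qed.

End harris.

(** * From means to probability measures *)

Section mean_integral.
Context {R : realType} {d : measure_display} {X : measurableType d}.

Lemma bmeas_integrable (P : probability X R) (f : X -> R) :
  bmeas f -> P.-integrable setT (EFin \o f).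
Proof.
move=> [mf [M fM]]; apply: measurable_bounded_integrable => //.
  by apply: le_lt_trans (probability_le1 P measurableT) (ltry _).
exists M; split; first exact: num_real.
by move=> x Mx y _; apply: (le_trans (fM y)); exact: ltW.
Qed.

Lemma mean_Rintegral (P : probability X R) :
  mean (fun f => Rintegral P setT f).
Proof.
split.
- move=> c; rewrite Rintegral_cst// [X in fine X](_ : _ = 1%E) ?mulr1//.
  exact: probability_setT.
- by move=> f g bf bg; rewrite RintegralD//; exact: bmeas_integrable.
- by move=> c f bf; rewrite RintegralZl//; exact: bmeas_integrable.
- by move=> f g bf bg fg; apply: le_Rintegral => //; exact: bmeas_integrable.
- move=> u bu u01 u0.
  have := @dominated_cvg _ _ _ P setT measurableT (fun n x => (u n x)%:E) (cst 0%E) (cst 1%E).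
  rewrite integral_cst// mul0e => H.
  have : (\int[P]_x (u n x)%:E)%E @[n --> \oo] --> 0%E.
    apply: H => //=.
    + by move=> n; apply/measurable_EFinP; have [] := bu n.
    + by move=> x _; apply: cvg_EFin; [exact: nearW|exact: u0].
    + exact: (bmeas_integrable P (bmeas_cst 1)).
    + by move=> n x _; rewrite lee_fin ger0_norm; have /andP[] := u01 n x.
  exact: fine_cvg.
Qed.

Lemma meanB (m : (X -> R) -> R) f g : mean m -> bmeas f -> bmeas g ->
  m (fun x => f x - g x) = m f - m g.
Proof.
move=> mm bf bg; rewrite -[in RHS]mulN1r -(meanZ mm) // -(meanD mm)//.
  by congr m; apply/funext => x; rewrite mulN1r.
exact: bmeasZ.
Qed.

Lemma bmeasB (f g : X -> R) : bmeas f -> bmeas g -> bmeas (fun x => f x - g x).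
Proof.
move=> bf bg; have -> : (fun x => f x - g x) = (fun x => f x + -1 * g x).
  by apply/funext => x; rewrite mulN1r.
by apply: bmeasD => //; exact: bmeasZ.
Qed.

Lemma bmeas_sum k (f : nat -> X -> R) : (forall i, bmeas (f i)) ->
  bmeas (fun x => \sum_(i < k) f i x).
Proof.
move=> bf; elim: k => [|k IH].
  by under eq_fun do rewrite big_ord0; exact: bmeas_cst.
by under eq_fun do rewrite big_ord_recr; exact: bmeasD.
Qed.

Lemma mean_sum (m : (X -> R) -> R) k (f : nat -> X -> R) : mean m ->
  (forall i, bmeas (f i)) ->
  m (fun x => \sum_(i < k) f i x) = \sum_(i < k) m (f i).
Proof.
move=> mm bf; elim: k => [|k IH].
  by under eq_fun do rewrite big_ord0; rewrite big_ord0 (mean_cst mm).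
under eq_fun do rewrite big_ord_recr.
by rewrite (meanD mm) ?IH ?big_ord_recr//; exact: bmeas_sum.
Qed.

(** The sum counts the positive integers up to [y], so it is the integer part of [y]. *)
Lemma staircase_approx (k : nat) (y : R) : 0 <= y <= k%:R ->
  `|y - \sum_(i < k) (i.+1%:R <= y)%R%:R| <= 1.
Proof.
move=> /andP[y0 yk].
suff -> : \sum_(i < k) (i.+1%:R <= y)%R%:R = (Num.truncn y)%:R :> R.
  have /andP[h1 h2] := truncn_itv y0.
  by rewrite ger0_norm ?subr_ge0// lerBlDr -natr1 addrC in h2 *; lra.
under eq_bigr => i _ do rewrite -truncn_gt_nat.
have tk : (Num.truncn y <= k)%N.
  by rewrite -(ler_nat R) (le_trans _ yk)// truncn_le.
rewrite -natr_sum; congr _%:R; rewrite -[RHS](minn_idPr tk).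
by elim: k {yk tk} => [|k IH]; rewrite ?big_ord0 ?min0n// big_ord_recr/= IH; lia.
Qed.

(** A measurable function with values in [[0, 1]] is uniformly within [1 / (k + 1)] of a staircase
    with [k + 1] steps, a combination of indicators of superlevel sets, and a mean is 1-Lipschitz
    for the uniform norm. The general case follows by affine rescaling. *)
Lemma mean_eq_indic (m n : (X -> R) -> R) : mean m -> mean n ->
  (forall A, measurable A -> m (\1_A) = n (\1_A)) ->
  forall f, bmeas f -> m f = n f.
Proof.
move=> mm mn mnA.
have mn01 f : bmeas f -> (forall x, 0 <= f x <= 1) -> m f = n f.
  move=> bf f01; apply/eqP; rewrite -subr_eq0 -normr_le0; apply/ler_addgt0Pr => e e0.
  rewrite add0r.
  have e20 : 0 < e / 2 by rewrite divr_gt0.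
  have /cvgrPdist_le /(_ _ e20)[k _ /(_ k (leqnn k))/=] := @cvg_harmonic R.
  rewrite sub0r normrN ger0_norm ?invr_ge0// => ke.
  pose A i := [set x | i.+1%:R <= k.+1%:R * f x].
  have mA i : measurable (A i).
    rewrite /A -[X in measurable X]setTI; apply: measurable_fun_ler => //.
    by apply: measurable_funM => //; have [] := bf.
  pose g x := \sum_(i < k.+1) k.+1%:R^-1 * \1_(A i) x : R.
  have bA i : bmeas (fun x => k.+1%:R^-1 * \1_(A i) x : R).
    exact/bmeasZ/bmeas_indic.
  have bg : bmeas g by exact: (@bmeas_sum k.+1 (fun i x => k.+1%:R^-1 * \1_(A i) x)).
  have mng : m g = n g.
    rewrite /g (@mean_sum m k.+1 (fun i x => k.+1%:R^-1 * \1_(A i) x))//.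
    rewrite (@mean_sum n k.+1 (fun i x => k.+1%:R^-1 * \1_(A i) x))//.
    apply: eq_bigr => i _; rewrite (meanZ mm) ?(meanZ mn) ?mnA//; exact: bmeas_indic.
  have k0 : 0 < k.+1%:R :> R by rewrite ltr0n.
  have fg x : `|f x - g x| <= e / 2.
    rewrite (le_trans _ ke)// -[leRHS]mulr1 -(ler_pM2l k0) mulrA divff ?gt_eqF// mul1r.
    rewrite -[X in X * _]gtr0_norm// -normrM mulrBr /g mulr_sumr.
    rewrite (_ : \sum_(i < k.+1) _ = \sum_(i < k.+1) (i.+1%:R <= k.+1%:R * f x)%R%:R).
      apply: staircase_approx; have /andP[f0 f1] := f01 x.
      by rewrite mulr_ge0//= -[leRHS]mulr1 ler_wpM2l.
    apply: eq_bigr => i _; rewrite mulrA divff ?gt_eqF// mul1r indicE.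
    by congr (nat_of_bool _)%:R; rewrite mem_setE.
  have -> : m f - n f = m (fun x => f x - g x) - n (fun x => f x - g x).
    by rewrite !meanB// mng; lra.
  rewrite (le_trans (ler_normB _ _))// [e]splitr lerD//.
  - by apply: (mean_norm_le mm) => //; exact: bmeasB.
  - by apply: (mean_norm_le mn) => //; exact: bmeasB.
move=> f bf; have [M M0 fM] := bmeas_ub bf.
(* An affine image of [f] inside [[0, 1]]; the summand with coefficient 0 only gives it the shape of
   [mean_lin]. *)
pose h x := 2^-1 + (2 * (M + 1))^-1 * f x + 0 * f x.
have bh : bmeas h by exact: bmeas_lin.
have M10 : 0 < M + 1 by rewrite ltr_wpDl.
have : m h = n h.
  apply: mn01 => // x; rewrite /h mul0r addr0.
  have := fM x; rewrite ler_norml => /andP[f1 f2].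
  have -> : 2^-1 + (2 * (M + 1))^-1 * f x = (M + 1 + f x) / (2 * (M + 1)).
    by field; rewrite gt_eqF.
  by rewrite divr_ge0 ?ler_pdivrMr ?mulr_gt0//; lra.
rewrite /h !mean_lin// !mul0r !addr0 => /addrI /mulfI; apply.
by rewrite invr_eq0 mulf_neq0// gt_eqF.
Qed.

End mean_integral.

Section measure_of_mean.
Context {R : realType} {d : measure_display} {X : measurableType d}.

(** The absolute value ensures nonnegativity on nonmeasurable sets as well, where [m] is not
    controlled. The proof of [mean m] is an argument so that the measure structure can be attached
    to [mean_prob mm]. *)
Definition mean_prob (m : (X -> R) -> R) (_ : mean m) (A : set X) : \bar R :=
  (`|m (\1_A)|)%:E.

Variables (m : (X -> R) -> R) (mm : mean m).

Lemma mean_probE A : measurable A -> mean_prob mm A = (m (\1_A))%:E.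
Proof.
move=> mA; rewrite /mean_prob ger0_norm// mean_ge0//; exact: bmeas_indic.
Qed.

Let mean_prob0 : mean_prob mm set0 = 0%E.
Proof. by rewrite /mean_prob indic0 (mean_cst mm 0) normr0. Qed.

Let mean_prob_ge0 A : (0 <= mean_prob mm A)%E.
Proof. by rewrite /mean_prob lee_fin. Qed.

Let mean_prob_sigma_additive : semi_sigma_additive (mean_prob mm).
Proof.
move=> F mF tF mUF; rewrite mean_probE//.
pose B n := \big[setU/set0]_(i < n) F i.
have mB n : measurable (B n) by exact: bigsetU_measurable.
have BS n : B n `<=` \bigcup_i F i.
  by move=> x; rewrite /B -bigcup_mkord => -[i _ Fi]; exists i.
have sumE n : (\sum_(0 <= i < n) mean_prob mm (F i))%E = (m (\1_(B n)))%:E.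
  elim: n => [|n IH]; first by rewrite big_geq// /B big_ord0 indic0 (mean_cst mm 0).
  rewrite big_nat_recr//= IH mean_probE// -EFinD; congr EFin.
  rewrite -(meanD mm); try exact: bmeas_indic.
  congr m; apply/funext => x; rewrite /B big_ord_recr/= !indicE in_setU.
  have [xB|] := boolP (x \in _); have [xF|] := boolP (x \in F n) => //=; rewrite ?addr0 ?add0r//.
  exfalso; move: xB xF; rewrite !inE -bigcup_mkord => -[i /= ni Fi] Fn.
  have := tF i n I I; move: ni => /[swap] /(_ (ex_intro _ x (conj Fi Fn))) ->.
  by rewrite ltnn.
under eq_cvg do rewrite sumE.
apply: cvg_EFin; first exact: nearW.
suff : m (\1_(B n)) @[n --> \oo] --> m (\1_(\bigcup_i F i)) by [].
rewrite -[X in _ --> X]subr0.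
(* The indicators of the tails of the union tend to 0 pointwise, which is what [mean_cvg0] asks
   for. *)
pose u n x := \1_(\bigcup_i F i `\` B n) x : R.
have mU n : measurable (\bigcup_i F i `\` B n) by exact: measurableD.
have -> : (fun n => m (\1_(B n))) = (fun n => m \1_(\bigcup_i F i) - m (u n)).
  apply/funext => n; rewrite -(meanB mm); try exact: bmeas_indic.
  congr m; apply/funext => x; rewrite /u !indicE in_setD.
  have [xB|] := boolP (x \in B n); last by rewrite andbT subrr.
  suff -> : x \in \bigcup_i F i by rewrite /= subr0.
  by rewrite inE; apply: (BS n); rewrite -inE.
apply: cvgB; first exact: cvg_cst.
apply: (mean_cvg0 mm) => [n|n x|x].
- exact: bmeas_indic.
- by rewrite /u indicE ler0n lern1 leq_b1.
- have [[k _ Fk]|nx] := pselect ((\bigcup_i F i) x); last first.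
    rewrite (_ : (fun n => _) = fun=> 0); first exact: cvg_cst.
    apply/funext => n; rewrite /u indicE (_ : x \in _ = false)//.
    by apply: memNset => -[].
  apply: cvg_near_cst; exists k.+1 => // n /= kn.
  rewrite /u indicE (_ : x \in _ = false)//; apply: memNset => -[_]; apply.
  by rewrite /B -bigcup_mkord; exists k.
Qed.

HB.instance Definition _ := isMeasure.Build _ _ _ (mean_prob mm)
  mean_prob0 mean_prob_ge0 mean_prob_sigma_additive.

Let mean_prob_setT : mean_prob mm setT = 1%E.
Proof. by rewrite /mean_prob indicT (mean_cst mm 1) normr1. Qed.

HB.instance Definition _ :=
  @Measure_isProbability.Build _ _ R (mean_prob mm) mean_prob_setT.

Lemma Rintegral_mean_prob f : bmeas f ->
  Rintegral (mean_prob mm) setT f = m f.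
Proof.
apply: mean_eq_indic => //; first exact: mean_Rintegral.
move=> A mA; transitivity (fine (mean_prob mm A)); last by rewrite mean_probE.
by rewrite /Rintegral integral_indic// setIT.
Qed.

End measure_of_mean.

(** Turns uniform bounds on truncated moments, the only ones that a mean provides, into
    integrability: the truncations at the integers increase to [W]. *)
Lemma integrable_truncP {R : realType} {d : measure_display}
    {X : measurableType d} (P : probability X R) (W : X -> R) (B : R) :
  measurable_fun setT W -> (forall x, 0 <= W x) ->
  (forall M, 0 <= M -> Rintegral P setT (fun x => Num.min (W x) M) <= B) ->
  P.-integrable setT (EFin \o W).
Proof.
move=> mW W0 WB; have mEW : measurable_fun setT (EFin \o W).
  exact/measurable_EFinP.
apply/integrableP; split => //.
under eq_integral do rewrite /= ger0_norm//.
pose g (n : nat) x := (Num.min (W x) n%:R)%:E.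
have bg (n : nat) := bmeas_trunc mW W0 (ler0n R n).
have <- : (\int[P]_x limn (g^~ x) = \int[P]_x (W x)%:E)%E.
  apply: eq_integral => x _; apply/cvg_lim => //; apply: cvg_near_cst.
  exists (Num.truncn (W x)).+1 => // n /= xn; rewrite /g (min_idPl _)//.
  by rewrite ltW// (lt_le_trans (truncnS_gt _))// ler_nat.
rewrite monotone_convergence//.
- apply: (@le_lt_trans _ _ B%:E); last exact: ltry.
  apply: lime_le.
    apply: ereal_nondecreasing_is_cvgn => a b ab.
    apply: ge0_le_integral => //.
    + by move=> x _; rewrite lee_fin le_min W0/=.
    + by apply/measurable_EFinP; have [] := bg a.
    + by apply/measurable_EFinP; have [] := bg b.
    + by move=> x _; rewrite lee_fin le_min ge_min lexx/= ge_min ler_nat ab orbT.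
  apply: nearW => n; rewrite -[leLHS]fineK ?lee_fin; first exact: WB.
  by apply: integrable_fin_num => //; exact: bmeas_integrable.
- by move=> n; apply/measurable_EFinP; have [] := bg n.
- by move=> n x _; rewrite lee_fin le_min W0/=.
- by move=> x _ a b ab; rewrite lee_fin le_min ge_min lexx/= ge_min ler_nat ab orbT.
Qed.

(** * Convergence and invariant law for a chain factored through a contracting one *)

Section ergodic.
Context {R : realType} {dX dY : measure_display}.
Context {X : measurableType dX} {Y : measurableType dY}.
Variables (K : (Y -> R) -> X -> R) (H : (X -> R) -> Y -> R).
Variables (V : Y -> R) (W : X -> R) (gam C al D : R) (nu : (Y -> R) -> R).
Hypotheses (mK : markov_op K) (mH : markov_op H) (mnu : mean nu).
Hypotheses (mV : measurable_fun setT V) (V0 : forall y, 0 <= V y).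
Hypotheses (mW : measurable_fun setT W) (W0 : forall x, 0 <= W x).
Hypotheses (gam01 : 0 < gam < 1) (C0 : 0 < C) (al01 : 0 < al < 1) (D0 : 0 <= D).
Hypothesis drift :
  forall y, mean_ub (fun f => H (K f) y) V (gam * V y + C).
Hypothesis minor : forall y, V y <= 4 * C / (1 - gam) ->
  forall f, bmeas f -> (forall x, 0 <= f x) -> al * nu f <= H (K f) y.
(** [W] is the weight on [X] matching [V] on [Y]: this bound controls [V] after [K], and [HW]
    controls [W] after [H], which makes [W] integrable under the limit law. *)
Hypothesis KV : forall x, mean_ub (fun f => K f x) V (W x).
Hypothesis HW : forall y, mean_ub (fun g => H g y) W (D + D * V y).

Let T f := H (K f).
Let P g := K (H g).
Let rho := harris_rate gam al.
Let b := harris_weight C al.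
Let C' := C / (1 - gam).

Let mT : markov_op T. Proof. exact: markov_op_comp. Qed.
Let mP : markov_op P. Proof. exact: markov_op_comp. Qed.
Let rho01 : 0 < rho < 1. Proof. exact: harris_rate01. Qed.
Let b0 : 0 < b. Proof. exact: harris_weight_gt0. Qed.

Let C'0 : 0 <= C'.
Proof. by have /andP[_ ?] := gam01; rewrite divr_ge0 ?subr_ge0// ltW. Qed.

Let iter_factor n g : iter n.+1 P g = K (iter n T (H g)).
Proof. by elim: n => // n IH; rewrite iterS IH. Qed.

Let KT_ub k x : mean_ub (fun f => K (iter k T f) x) V (C' + 1 * W x).
Proof.
move=> M M0; have bVM := bmeas_trunc mV V0 M0.
apply: (mean_le_affine (mK.2 x) mV V0 (@KV x)) => //.
  by have [+ _] := markov_op_iter k mT; exact.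
move=> y; rewrite mul1r addrC.
exact: (drift_iter mT mV V0 gam01 C0 drift).
Qed.

Let Q x x' := 2 + b * W x + b * (C' + W x').

Let Q_ge0 x x' : 0 <= Q x x'.
Proof. by rewrite !addr_ge0// mulr_ge0// ?addr_ge0// ltW. Qed.

(** Both terms are means of the same [iter n T (H g)], whose oscillation the contraction has already
    bounded: one under [K] from [x], the other under [K] and [k] further steps of [T] from [x']. The
    bound is free of [k], so it gives the Cauchy property for [x = x'] and the rate of convergence
    as [k] grows. *)
Lemma iter_compare n k g x x' : bmeas g -> (forall z, `|g z| <= 1) ->
  `|iter n.+1 P g x - iter (n + k).+1 P g x'| <= rho ^+ n * Q x x'.
Proof.
move=> bg g1; rewrite !iter_factor addnC iterD.
have bHg : bmeas (H g) by exact: mH.1.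
have Hg1 y : `|H g y| <= 1 by apply: mean_norm_le (mH.2 y) bg g1.
have := harris_iter mT mnu mV V0 gam01 C0 al01 drift minor n bHg Hg1.
set f := iter n T (H g) => fV.
have bf : bmeas f by have [+ _] := markov_op_iter n mT; exact.
have [_ mKT] := markov_op_comp mK (markov_op_iter k mT).
have z01 : 0 <= (0 : R) < 1 by rewrite lexx ltr01.
have r0 : 0 <= rho ^+ n by rewrite exprn_ge0// ltW//; have /andP[] := rho01.
have zm (m : (Y -> R) -> R) : mean m ->
    forall g, bmeas g -> (forall x, 0 <= g x) -> 0 * nu g <= m g.
  by move=> mm h bh h0; rewrite mul0r mean_ge0.
rewrite ler_norml; apply/andP; split.
  rewrite lerNl opprB.
  have := mean_oscillation_ub (mKT x') (mK.2 x) mnu z01 r0 b0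
    (zm _ (mKT x')) (zm _ (mK.2 x)) bf mV V0 (@KT_ub k x') (@KV x) fV.
  by rewrite /Q; lra.
have := mean_oscillation_ub (mK.2 x) (mKT x') mnu z01 r0 b0
  (zm _ (mK.2 x)) (zm _ (mKT x')) bf mV V0 (@KV x) (@KT_ub k x') fV.
by rewrite /Q; lra.
Qed.

(** An arbitrary start; [rate] shows that every other start leads to the same limit. *)
Let x0 : X := point.

Let iter_is_cvg1 g : bmeas g -> (forall z, `|g z| <= 1) ->
  cvgn (fun n => iter n P g x0).
Proof.
move=> bg g1; apply/cauchy_cvgP; apply/cauchy_exP => e e0.
have rQ : rho ^+ n * Q x0 x0 @[n --> \oo] --> (0 : R).
  rewrite -[X in _ --> X](mul0r (Q x0 x0)); apply: cvgMl.
  by apply: cvg_expr; have /andP[? ?] := rho01; rewrite ger0_norm// ltW.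
have /cvgrPdist_lt /(_ _ e0)[n _ /(_ n (leqnn n))/=] := rQ.
rewrite sub0r normrN ger0_norm ?mulr_ge0 ?exprn_ge0//; last first.
  by have /andP[? _] := rho01; rewrite ltW.
move=> rQe; exists (iter n.+1 P g x0); exists n.+1 => // k /= nk.
rewrite /ball /= -(subnKC nk) addSn.
exact: le_lt_trans (iter_compare _ _ _ _ bg g1) rQe.
Qed.

Let iter_is_cvg g : bmeas g -> cvgn (fun n => iter n P g x0).
Proof.
move=> bg; have [M M0 gM] := bmeas_ub bg.
have M1 : 0 < M + 1 by rewrite ltr_wpDl.
have -> : (fun n => iter n P g x0) =
    (fun n => (M + 1) * iter n P (fun z => (M + 1)^-1 * g z) x0).
  apply/funext => n; have [_ mPn] := markov_op_iter n mP.
  by rewrite (meanZ (mPn x0))// mulrA divff ?gt_eqF// mul1r.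
apply: is_cvgM; first exact: is_cvg_cst.
apply: iter_is_cvg1; first exact: bmeasZ.
move=> z; rewrite normrM gtr0_norm ?invr_gt0// ler_pdivrMl// mulr1.
by rewrite (le_trans (gM z))// lerDl.
Qed.

Let L g := limn (fun n => iter n P g x0).

Let iter_cvg g : bmeas g -> iter n P g x0 @[n --> \oo] --> L g.
Proof. by move=> bg; exact: iter_is_cvg. Qed.

Let rate g n x : bmeas g -> (forall z, `|g z| <= 1) ->
  `|iter n.+1 P g x - L g| <= rho ^+ n * Q x x0.
Proof.
move=> bg g1.
have cvg1 : `|iter n.+1 P g x - iter k P g x0| @[k --> \oo] --> `|iter n.+1 P g x - L g|.
  by apply: cvg_norm; apply: cvgB; [exact: cvg_cst|exact: iter_cvg].
rewrite -(cvg_lim _ cvg1)//; apply: limr_le; first by apply/cvg_ex; eexists; exact: cvg1.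
exists n.+1 => // k /= nk; rewrite -(subnKC nk) addSn.
exact: iter_compare.
Qed.

(** The delicate clause is the last, an exchange of limits. The rate is uniform over functions
    bounded by 1, so one fixed [n] approximates [L (u j)] for all [j] at once, and the continuity of
    [iter n.+1 P] at [x0] does the rest. *)
Let mean_L : mean L.
Proof.
have mPn n := (markov_op_iter n mP).2.
split.
- move=> c; rewrite /L (_ : (fun n => _) = fun=> c); first exact: lim_cst.
  by apply/funext => n; rewrite (mean_cst (mPn n x0)).
- move=> f g bf bg; apply/cvg_lim => //.
  rewrite (_ : (fun n => _) = fun n => iter n P f x0 + iter n P g x0).
    by apply: cvgD; exact: iter_cvg.
  by apply/funext => n; rewrite (meanD (mPn n x0)).
- move=> c f bf; apply/cvg_lim => //.
  rewrite (_ : (fun n => _) = fun n => c * iter n P f x0).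
    by apply: cvgM; [exact: cvg_cst|exact: iter_cvg].
  by apply/funext => n; rewrite (meanZ (mPn n x0)).
- move=> f g bf bg fg; apply: ler_lim; [exact: iter_cvg|exact: iter_cvg|].
  by apply: nearW => n; apply: (mean_le (mPn n x0)).
- move=> u bu u01 u0; apply/cvgrPdist_le => e e0.
  have rQ : rho ^+ n * Q x0 x0 @[n --> \oo] --> (0 : R).
    rewrite -[X in _ --> X](mul0r (Q x0 x0)); apply: cvgMl.
    by apply: cvg_expr; have /andP[? ?] := rho01; rewrite ger0_norm// ltW.
  have e20 : 0 < e / 2 by rewrite divr_gt0.
  have /cvgrPdist_le /(_ _ e20)[n _ /(_ n (leqnn n))/=] := rQ.
  rewrite sub0r normrN ger0_norm ?mulr_ge0 ?exprn_ge0//; last first.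
    by have /andP[? _] := rho01; rewrite ltW.
  move=> rQe.
  have /cvgrPdist_le /(_ _ e20)[k _ uk] := mean_cvg0 (mPn n.+1 x0) bu u01 u0.
  exists k => // j /= kj; rewrite sub0r normrN.
  have := uk _ kj; rewrite /= sub0r normrN => {}uk.
  have u1 z : `|u j z| <= 1 by have /andP[? ?] := u01 j z; rewrite ger0_norm.
  have := rate n x0 (bu j) u1 => rj.
  rewrite -[L _](subrK (iter n.+1 P (u j) x0)) [e]splitr.
  rewrite (le_trans (ler_normD _ _))// lerD// distrC.
  exact: le_trans rj rQe.
Qed.

Theorem harris_ergodic : exists (pi : probability X R) (c : R) (q : X -> R),
  [/\ 0 < c < 1, measurable_fun setT q /\ forall x, 0 <= q x,
      pi.-integrable setT (EFin \o q),
      forall n g x, bmeas g -> (forall z, `|g z| <= 1) ->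
        `|iter n P g x - Rintegral pi setT g| <= c ^+ n * q x &
      forall g, bmeas g -> Rintegral pi setT (P g) = Rintegral pi setT g].
Proof.
have [r0 r1] := andP rho01.
(* Dividing by [rho] repairs the index shift, since [rate] bounds the error after [n.+1] steps by
   [rho ^+ n]. For [n = 0] the error is at most 2, hence at most [Q x x0]. *)
exists (mean_prob mean_L), rho, (fun x => Q x x0 / rho); split => //.
- split; last by move=> x; rewrite divr_ge0// ltW.
  apply: measurable_funM => //; apply: measurable_funD => //.
  by apply: measurable_funD => //; exact: measurable_funM.
- have iW : (mean_prob mean_L).-integrable setT (EFin \o W).
    apply: (@integrable_truncP _ _ _ _ _ (D + D * (C' + 1 * W x0))) => // M M0.
    have bWM := bmeas_trunc mW W0 M0.
    rewrite Rintegral_mean_prob//.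
    apply: limr_le; first exact: iter_is_cvg.
    exists 1%N => // -[//|n] _; rewrite iter_factor.
    have [_ mKT] := markov_op_comp mK (markov_op_iter n mT).
    apply: (mean_le_affine (mKT x0) mV V0 (@KT_ub n x0) (mH.1 _ bWM) D0).
    by move=> y; exact: HW.
  rewrite (_ : _ \o _ = (fun x => ((2 + b * (C' + W x0)) / rho)%:E + (b / rho)%:E * (W x)%:E)%E).
    apply: integrableD => //.
      exact: (bmeas_integrable _ (bmeas_cst _)).
    exact: integrableZl.
  by apply/funext => x /=; rewrite -EFinM -EFinD /Q; congr EFin; field; rewrite gt_eqF.
- move=> n g x bg g1; rewrite Rintegral_mean_prob//; case: n => [|n].
    rewrite expr0 mul1r /= (le_trans (ler_normB _ _))//.
    apply: (@le_trans _ _ (Q x x0)).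
      apply: (@le_trans _ _ (1 + 1)).
        by rewrite lerD//; exact: mean_norm_le mean_L bg g1.
      rewrite /Q -addrA lerDl addr_ge0// mulr_ge0 ?addr_ge0//; exact: ltW.
    by rewrite ler_pdivlMr// ler_piMr// ltW.
  rewrite exprSr -mulrA (mulrCA rho) divff ?gt_eqF// mulr1.
  exact: rate.
- move=> g bg; rewrite !Rintegral_mean_prob//; last exact: mP.1.
  have h : [sequence iter n.+1 P g x0]_n @ \oo --> L g.
    by rewrite (cvg_shiftS (fun n => iter n P g x0)); exact: iter_cvg.
  rewrite {1}/L (_ : (fun n => _) = [sequence iter n.+1 P g x0]_n).
    exact: cvg_lim h.
  by apply/funext => n; rewrite -iterSr.
Qed.

End ergodic.

(** * Gaussian integrals *)

Section integral_density.
Local Open Scope ereal_scope.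
Context {d : measure_display} {T : measurableType d} {R : realType}.
Variables (mu nu : {measure set T -> \bar R}) (p : T -> R).
Hypotheses (mp : measurable_fun setT p) (p0 : forall x, (0 <= p x)%R).
Hypothesis nuE : forall A, measurable A -> nu A = \int[mu]_(x in A) (p x)%:E.

Import HBNNSimple.

(** On indicators this is [nuE]; linearity extends it to simple functions and monotone convergence
    to all nonnegative ones. *)
Lemma ge0_integral_density (f : T -> \bar R) : measurable_fun setT f ->
  (forall x, 0 <= f x) -> \int[nu]_x f x = \int[mu]_x (f x * (p x)%:E).
Proof.
move=> mf f0; pose f_ := nnsfun_approx measurableT mf.
have f_cvg x : (f_ n x)%:E @[n --> \oo] --> f x.
  by apply: cvg_nnsfun_approx => // *; exact: f0.
have f_nd x : {homo (fun n => (f_ n x)%:E) : m n / (m <= n)%N >-> m <= n}.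
  by move=> m n mn; rewrite lee_fin; exact/lefP/nd_nnsfun_approx.
have mEp : measurable_fun setT (EFin \o p) by exact/measurable_EFinP.
transitivity (limn (fun n => \int[nu]_x (f_ n x)%:E)).
  rewrite -monotone_convergence//.
  - by apply: eq_integral => x _; apply/esym/cvg_lim.
  - by move=> n; exact/measurable_EFinP/measurable_funP.
  - by move=> n y _; rewrite lee_fin.
transitivity (limn (fun n => \int[mu]_x ((f_ n x)%:E * (p x)%:E))); last first.
  rewrite -monotone_convergence//.
  - apply: eq_integral => x _; apply/cvg_lim => //.
    by apply: cvgeZr => //.
  - by move=> n; apply: emeasurable_funM => //; exact/measurable_EFinP/measurable_funP.
  - by move=> n y _; rewrite mule_ge0 ?lee_fin.
  - by move=> x _ m n mn; apply: lee_wpmul2r; rewrite ?lee_fin//; exact: f_nd.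
congr (limn _); apply/funext => n.
have indich r : measurable_fun setT (fun x => (r * \1_(f_ n @^-1` [set r]) x)%:E).
  by apply: (measurable_comp measurableT) => //; exact: measurable_funM.
transitivity (\int[nu]_x
    (\sum_(y \in range (f_ n)) (y * \1_(f_ n @^-1` [set y]) x)%:E)).
  by apply: eq_integral => t tE; rewrite /= fimfunE -fsumEFin.
rewrite ge0_integral_fsum//; last by move=> m y Ey; exact: nnfun_muleindic_ge0.
transitivity (\int[mu]_x (\sum_(y \in range (f_ n))
    (y * \1_(f_ n @^-1` [set y]) x)%:E * (p x)%:E)); last first.
  under [LHS]eq_integral => x xE.
    rewrite -ge0_mule_fsuml => [|y]; last exact: nnfun_muleindic_ge0.
    rewrite fsumEFin // -(fimfunE _ x); over.
  by [].
rewrite ge0_integral_fsum//; last 2 first.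
  - by move=> y; exact: emeasurable_funM.
  - move=> m y Ey; apply: mule_ge0; last by rewrite lee_fin.
    exact: nnfun_muleindic_ge0.
apply: eq_fsbigr => r rhn.
under [LHS]eq_integral do rewrite EFinM.
rewrite integralZl_indic_nnsfun => //.
under [RHS]eq_integral do rewrite EFinM -muleA.
rewrite ge0_integralZl//.
- under [in RHS]eq_integral do rewrite muleC.
  rewrite [in RHS](eq_integral ((EFin \o p) \_ (f_ n @^-1` [set r]))); last first.
    by move=> x xE; rewrite epatch_indic.
  by rewrite -integral_mkcond integral_indic// setIT nuE.
- by apply: emeasurable_funM => //; exact/measurable_EFinP.
- by move=> t Et; rewrite mule_ge0 ?lee_fin.
- by move: rhn; rewrite inE => -[t _ <-]; rewrite lee_fin.
Qed.

End integral_density.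

Section lebesgue_translation.
Context {R : realType}.
Local Notation mu := (@lebesgue_measure R).

Lemma measurable_id_R : measurable_fun setT (fun x : measurableTypeR R => x : R).
Proof. exact: measurable_id. Qed.

Lemma lebesgue_measure_translation (c : R) (A : set (measurableTypeR R)) :
  measurable A ->
  pushforward mu (fun x : measurableTypeR R => (x + c)%R : measurableTypeR R) A = mu A.
Proof.
have mc : measurable_fun setT
    (fun x : measurableTypeR R => (x + c)%R : measurableTypeR R).
  exact: (@measurable_funD _ (measurableTypeR R)).
move=> mA; apply/esym/lebesgue_measure_unique => //= _ [[a b]] _ <-.
rewrite /pushforward.
rewrite (_ : _ @^-1` _ = `]a - c, b - c]%classic); last first.
  by apply/seteqP; split => x /=; rewrite !in_itv/= ltrBlDr lerBrDr.
rewrite !lebesgue_measure_itv/= !lte_fin ltrD2r; case: ifPn => // _.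
by rewrite -!EFinB; congr EFin; ring.
Qed.

Lemma ge0_integral_translation (c : R) (f : measurableTypeR R -> \bar R) :
  measurable_fun setT f -> (forall x, 0 <= f x)%E ->
  (\int[mu]_x f (x + c)%R = \int[mu]_x f x)%E.
Proof.
move=> mf f0.
have mc : measurable_fun setT
    (fun x : measurableTypeR R => (x + c)%R : measurableTypeR R).
  exact: (@measurable_funD _ (measurableTypeR R)).
rewrite -(@ge0_integral_pushforward _ _ _ _ _ _ mc mu setT f)//.
by apply: eq_measure_integral => //= A mA _; exact: lebesgue_measure_translation.
Qed.
End lebesgue_translation.

Lemma lebesgue_stieltjes_measure_oc {R : realType} (f : cumulative R R) (a b : R) :
  a <= b -> lebesgue_stieltjes_measure f `]a, b] = (f b - f a)%:E.
Proof.
move=> ab; rewrite /lebesgue_stieltjes_measure /measure_extension/=.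
by rewrite measurable_mu_extE/= ?wlength_itv_bnd//; exact: is_ocitv.
Qed.

(** * Lebesgue measure under the square map *)

Section square_image.
Context {R : realType}.
Local Notation mu := (@lebesgue_measure R).
Local Notation RT := (measurableTypeR R).

(** Composing with this truncation makes the Stieltjes functions below constant outside [[lo, hi]],
    so that their measures live on []lo, hi]]. *)
Let clip (lo hi x : R) := Num.min (Num.max x lo) hi.

Let clip_itv (lo hi a b x : R) : lo < hi ->
  (a < x <= b) && (lo < x <= hi) = (clip lo hi a < x <= clip lo hi b).
Proof.
move=> lohi; rewrite /clip gt_min le_min gt_max le_max.
have [lox|xlo] := ltP lo x; have [xhi|hix] := leP x hi;
  rewrite ?andbT ?andbF ?orbF//=.
Qed.

Let clip_nd (lo hi : R) : {homo clip lo hi : x y / x <= y}.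
Proof.
move=> x y xy; rewrite /clip le_min ge_min ge_max le_max xy/= ge_min lexx orbT andbT.
by rewrite le_max lexx orbT.
Qed.

Let clip_bnd (lo hi x : R) : lo < hi -> lo <= clip lo hi x <= hi.
Proof. by move=> lohi; rewrite /clip le_min le_max lexx orbT (ltW lohi) ge_min lexx orbT. Qed.

Let clip_continuous (lo hi : R) : continuous (clip lo hi).
Proof.
by apply: min_fun_continuous; [apply: max_fun_continuous|]; move=> x;
  [exact: cvg_id|exact: cvg_cst|exact: cvg_cst].
Qed.

(* The square map is [2 * sqrt hi]-Lipschitz on [[0, sqrt hi]]: the Stieltjes
   measure of [sqrt - id / (2 * sqrt hi)] accounts for the difference. *)
Lemma lebesgue_measure_sqr_preimage (lo hi : R) (A : set RT) :
  0 < lo -> lo < hi -> measurable A ->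
  (((2 * Num.sqrt hi)^-1)%:E * mu (A `&` `]lo, hi]) <=
   mu ([set z : R | A (z ^+ 2)%R] `&` `]Num.sqrt lo, Num.sqrt hi]))%E.
Proof.
move=> lo0 lohi mA.
have hi0 : 0 < hi by exact: lt_trans lohi.
have shi0 : 0 < 2 * Num.sqrt hi by rewrite mulr_gt0 ?sqrtr_gt0.
pose k := (2 * Num.sqrt hi)^-1.
have k0 : 0 <= k by rewrite invr_ge0 ltW.
pose c := clip lo hi.
pose F x := Num.sqrt (c x).
pose D x := F x - k * c x.
have cb x : lo <= c x <= hi by exact: clip_bnd.
have F_continuous : continuous F.
  move=> x; apply: continuous_comp; first exact: clip_continuous.
  exact: sqrt_continuous.
have F_nd : {homo F : x y / x <= y}.
  by move=> x y xy; rewrite ler_wsqrtr// clip_nd.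
have D_nd : {homo D : x y / x <= y}.
  move=> x y xy; rewrite /D.
  have cxy := clip_nd lo hi xy; rewrite -/c in cxy.
  have [x1 x2] := andP (cb x); have [y1 y2] := andP (cb y).
  have Fxy := F_nd _ _ xy.
  have Fx : F x <= Num.sqrt hi by rewrite ler_wsqrtr.
  have Fy : F y <= Num.sqrt hi by rewrite ler_wsqrtr.
  suff : k * (c y - c x) <= F y - F x by lra.
  rewrite ler_pdivrMl//.
  have -> : c x = F x ^+ 2 by rewrite sqr_sqrtr// (le_trans (ltW lo0)).
  have -> : c y = F y ^+ 2 by rewrite sqr_sqrtr// (le_trans (ltW lo0)).
  nra.
have D_continuous : continuous D.
  move=> x; apply: cvgB; first exact: F_continuous.
  apply: cvgM; first exact: cvg_cst.
  exact: clip_continuous.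
pose cF : cumulative R R := HB.pack F
  (isCumulative.Build R _ R F F_nd (right_continuousW F_continuous)).
pose cD : cumulative R R := HB.pack D
  (isCumulative.Build R _ R D D_nd (right_continuousW D_continuous)).
have mI : measurable (`]lo, hi]%classic : set RT) by exact: measurable_itv.
have mJ : measurable (`]Num.sqrt lo, Num.sqrt hi]%classic : set RT) by exact: measurable_itv.
have msqr : measurable_fun setT (fun z : RT => z ^+ 2 : RT).
  exact: (@measurable_funX _ RT).
pose m1 : {measure set RT -> \bar R} :=
  measure_add (lebesgue_stieltjes_measure cD) (mscale (NngNum k0) (mrestr mu mI)).
have m1E X : m1 X = (lebesgue_stieltjes_measure cD X + k%:E * mu (X `&` `]lo, hi]))%E.
  exact: measure_addE.
(* [F = D + k * c], and the Stieltjes measure of [c] is Lebesgue measure on []lo, hi]]. Discarding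
   the part of [D] will give the inequality. *)
have E1 : lebesgue_stieltjes_measure cF A = m1 A.
  apply: lebesgue_stieltjes_measure_unique => // _ [[a b]] /= _ <-.
  have [ab|ba] := leP a b; last first.
    by rewrite set_itv_ge ?measure0// bnd_simp -leNgt ltW.
  rewrite m1E !lebesgue_stieltjes_measure_oc//=.
  rewrite (_ : `]a, b] `&` `]lo, hi] = `]c a, c b]%classic); last first.
    apply/seteqP; split => x /=; rewrite !in_itv/=.
      by move=> [ax bx]; rewrite -clip_itv// ax bx.
    by rewrite -clip_itv// => /andP[].
  rewrite lebesgue_measure_itv/= lte_fin.
  have := clip_nd lo hi ab; rewrite -/c le_eqVlt => /predU1P[cab|->].
    by rewrite cab ltxx mule0 adde0 /D cab; congr EFin; rewrite /F cab; ring.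
  by rewrite -EFinB -EFinM -EFinD; congr EFin; rewrite /D; ring.
(* The same measure is also the image under squaring of Lebesgue measure on []Num.sqrt lo, Num.sqrt
   hi]], because [F] inverts the square there. *)
have E2 : lebesgue_stieltjes_measure cF A =
    pushforward (mrestr mu mJ) (fun z : RT => z ^+ 2 : RT) A.
  apply: lebesgue_stieltjes_measure_unique => //= _ [[a b]] _ <-.
  have [ab|ba] := leP a b; last first.
    by rewrite set_itv_ge ?measure0// bnd_simp -leNgt ltW.
  rewrite lebesgue_stieltjes_measure_oc//= /pushforward /mrestr.
  rewrite (_ : _ `&` _ = `]F a, F b]%classic); last first.
    have sqE (z u : R) : 0 <= u -> 0 < z -> (Num.sqrt u < z) = (u < z ^+ 2).
      move=> u0 z0; rewrite -[in RHS](sqr_sqrtr u0) ltr_pXn2r// nnegrE//.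
      exact: ltW.
    have sqE' (z u : R) : 0 <= u -> 0 < z -> (z <= Num.sqrt u) = (z ^+ 2 <= u).
      by move=> u0 z0; rewrite leNgt sqE// -leNgt.
    have lo0' := ltW lo0; have hi0' := ltW hi0.
    have c0 x : 0 <= c x by have /andP[/(le_trans lo0')] := cb x.
    apply/seteqP; split => x /=; rewrite !in_itv/=.
      move=> [ax /andP[lox hix]].
      have x0 : 0 < x by rewrite (le_lt_trans _ lox)// sqrtr_ge0.
      rewrite /F sqE// sqE'// -clip_itv// ax/= -sqE// lox/=.
      by rewrite -sqE'.
    move=> /andP[ax bx].
    have x0 : 0 < x by rewrite (le_lt_trans _ ax)// sqrtr_ge0.
    move: ax bx; rewrite /F !sqE// !sqE'// => ax bx.
    have := clip_itv a b (x ^+ 2) lohi; rewrite ax bx => /andP[].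
    by move=> -> ->.
  rewrite lebesgue_measure_itv/= lte_fin.
  have := F_nd _ _ ab; rewrite le_eqVlt => /predU1P[cab|->//].
  by rewrite cab ltxx subrr.
rewrite -[leRHS]/(pushforward (mrestr mu mJ) (fun z : RT => z ^+ 2 : RT) A).
by rewrite -E2 E1 m1E leeDr.
Qed.
End square_image.

Section normal_law.
Context {R : realType}.
Local Notation mu := (@lebesgue_measure R).
Local Notation RT := (measurableTypeR R).
Local Notation N := (@normal_prob R 0 1).
Local Notation phi := (@normal_pdf R 0 1).
Local Open Scope ereal_scope.

Lemma measurable_std_normal_pdf : measurable_fun setT (phi : RT -> R).
Proof. exact: measurable_normal_pdf. Qed.

Lemma std_normal_pdfE (x : R) : phi x = (normal_peak 1 * expR (- (x ^+ 2 / 2)))%R.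
Proof.
rewrite normal_pdfE ?oner_neq0// /normal_fun; congr (_ * expR _)%R.
by rewrite subr0 expr1n mulNr.
Qed.

Lemma ge0_integral_normal (f : RT -> \bar R) : measurable_fun setT f ->
  (forall x, 0 <= f x) -> \int[N]_x f x = \int[mu]_x (f x * (phi x)%:E).
Proof.
move=> mf f0; apply: ge0_integral_density => //; first exact: measurable_std_normal_pdf.
by move=> x; exact: normal_pdf_ge0.
Qed.

Lemma ge0_integral_mrestr (D : set RT) (mD : measurable D) (f : RT -> \bar R) :
  measurable_fun setT f -> (forall x, 0 <= f x) ->
  \int[mrestr mu mD]_x f x = \int[mu]_x (f x * (\1_D x)%:E).
Proof.
move=> mf f0; apply: ge0_integral_density => // A mA.
by rewrite integral_indic// setIC.
Qed.

(** Since [x^2 / 4 <= exp (x^2 / 4)], the integrand is at most a multiple of the normal density of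
    variance 2. *)
Lemma normal_second_moment : \int[N]_x ((x : R) ^+ 2)%:E < +oo.
Proof.
have s2 : Num.sqrt 2 != 0%R :> R by rewrite gt_eqF// sqrtr_gt0.
have mx2 : measurable_fun setT (fun x : RT => ((x : R) ^+ 2)%R).
  exact: (@measurable_funX _ RT).
rewrite ge0_integral_normal//; last first.
- by move=> x; rewrite lee_fin sqr_ge0.
- exact/measurable_EFinP.
have pk := @normal_peak_gt0 R _ s2.
pose c := (4 * normal_peak 1 / normal_peak (Num.sqrt 2) : R)%R.
have c0 : (0 <= c)%R by rewrite divr_ge0 ?mulr_ge0 ?normal_peak_ge0.
apply: (@le_lt_trans _ _ (\int[mu]_x (c%:E * (normal_pdf 0 (Num.sqrt 2) x)%:E))); last first.
  rewrite ge0_integralZl//.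
  - by rewrite integral_normal_pdf mule1 ltry.
  - by apply/measurable_EFinP; exact: measurable_normal_pdf.
  - by move=> x _; rewrite lee_fin normal_pdf_ge0.
apply: ge0_le_integral => //.
- by move=> x _; rewrite mule_ge0 ?lee_fin ?sqr_ge0 ?normal_pdf_ge0.
- apply: emeasurable_funM; first exact/measurable_EFinP.
  by apply/measurable_EFinP; exact: measurable_std_normal_pdf.
- by apply: emeasurable_funM => //; apply/measurable_EFinP; exact: measurable_normal_pdf.
move=> x _; rewrite -!EFinM lee_fin std_normal_pdfE normal_pdfE// /normal_fun.
rewrite subr0 sqr_sqrtr// /c.
rewrite [X in (_ <= X)%R](_ : _ = normal_peak 1 * (4 * expR (- (x ^+ 2 / 4))))%R; last first.
  have -> : (- x ^+ 2 / (2 *+ 2) = - (x ^+ 2 / 4) :> R)%R.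
    by rewrite mulNr -[(2 *+ 2)%R]mulr_natr; congr (- (_ / _))%R; ring.
  by field; rewrite gt_eqF.
rewrite mulrCA ler_wpM2l ?normal_peak_ge0//.
have -> : (- (x ^+ 2 / 2) = - (x ^+ 2 / 4) + - (x ^+ 2 / 4) :> R)%R by field.
rewrite expRD mulrA ler_wpM2r ?expR_ge0// expRN ler_pdivrMr ?expR_gt0//.
have := expR_ge1Dx (x ^+ 2 / 4); lra.
Qed.

End normal_law.

(** * Lower bounds for squares of shifted normal variables *)

Section normal_minorization.
Context {R : realType}.
Local Notation mu := (@lebesgue_measure R).
Local Notation RT := (measurableTypeR R).
Local Notation N := (@normal_prob R 0 1).
Local Notation phi := (@normal_pdf R 0 1).
Local Open Scope ereal_scope.

(** Only the branch [z > m] is kept. For [e] in [[Q + 1, Q + 2]] the square [e - q] stays in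
    [[1, 2 * Q + 2]], inside []lo, hi]]. It is thus away from 0 and bounded: on the corresponding
    [z] the normal density is at least the [c] of the proof, and squaring transports Lebesgue
    measure with a factor at least [(2 * Num.sqrt hi)^-1], whatever [m] and [q]. *)
Lemma normal_sqr_minorization (M Q : R) : (0 <= M)%R -> (0 <= Q)%R ->
  exists2 k : R, (0 < k)%R & forall m q : R, (`|m| <= M)%R -> (`|q| <= Q)%R ->
    forall h : RT -> \bar R, measurable_fun setT h -> (forall x, 0 <= h x) ->
    k%:E * \int[mu]_(e in `[(Q + 1)%R, (Q + 2)%R]) h e <=
      \int[N]_z h ((z - m) ^+ 2 + q)%R.
Proof.
move=> M0 Q0; pose lo : R := (2^-1)%R; pose hi : R := (2 * Q + 3)%R.
have lo0 : (0 < lo)%R by rewrite /lo invr_gt0.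
have lohi : (lo < hi)%R by rewrite /lo /hi; lra.
have hi0 : (0 < hi)%R := lt_trans lo0 lohi.
pose c : R := (normal_peak 1 * expR (- ((Num.sqrt hi + M) ^+ 2 / 2)))%R.
have c0 : (0 < c)%R by rewrite mulr_gt0 ?normal_peak_gt0 ?oner_neq0 ?expR_gt0.
pose k : R := ((2 * Num.sqrt hi)^-1)%R.
have k0 : (0 < k)%R by rewrite invr_gt0 mulr_gt0 ?sqrtr_gt0.
exists (c * k)%R; first exact: mulr_gt0.
move=> m q mM qQ h mh h0.
pose J : set RT := `]Num.sqrt lo, Num.sqrt hi]%classic.
pose I : set RT := `]lo, hi]%classic.
have mI : measurable I by exact: measurable_itv.
have mJ : measurable J by exact: measurable_itv.
have msqr : measurable_fun setT (fun z : RT => z ^+ 2 : RT)%R.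
  exact: (@measurable_funX _ RT).
have mshift (r : R) : measurable_fun setT (fun z : RT => z + r : RT)%R.
  exact: (@measurable_funD _ RT).
have mhq : measurable_fun setT (fun e : RT => h (e + q)%R).
  exact: (measurableT_comp mh (mshift q)).
have mhsq : measurable_fun setT (fun y : RT => h (y ^+ 2 + q)%R).
  exact: (measurableT_comp mhq msqr).
have mhm : measurable_fun setT (fun z : RT => h ((z - m) ^+ 2 + q)%R).
  exact: (measurableT_comp mhsq (mshift (- m)%R)).
rewrite ge0_integral_normal//.
have -> : \int[mu]_x (h ((x - m) ^+ 2 + q)%R * (phi x)%:E) =
    \int[mu]_y (h (y ^+ 2 + q)%R * (phi (y + m)%R)%:E).
  rewrite -(@ge0_integral_translation _ m (fun x => h ((x - m) ^+ 2 + q)%R * (phi x)%:E)).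
  - by apply: eq_integral => y _; rewrite addrK.
  - by apply: emeasurable_funM => //; apply/measurable_EFinP; exact: measurable_std_normal_pdf.
  - by move=> x; rewrite mule_ge0// lee_fin normal_pdf_ge0.
have mh1 : measurable_fun setT (fun y : RT => h (y ^+ 2 + q)%R * (\1_J y)%:E).
  by apply: emeasurable_funM => //; exact/measurable_EFinP.
apply: (@le_trans _ _ (c%:E * \int[mu]_y (h (y ^+ 2 + q)%R * (\1_J y)%:E))); last first.
  rewrite -ge0_integralZl//; last 2 first.
  - by move=> y _; rewrite mule_ge0// lee_fin indicE.
  - by rewrite lee_fin ltW.
  apply: ge0_le_integral => //.
  - by move=> y _; rewrite !mule_ge0// lee_fin ?indicE// ltW.
  - exact: emeasurable_funM.
  - apply: emeasurable_funM => //; apply/measurable_EFinP.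
    by apply: measurableT_comp (mshift m) => //; exact: measurable_std_normal_pdf.
  - move=> y _; rewrite indicE; have [yJ|_] := boolP (y \in J); last first.
      by rewrite mulr0n mule0 mule0 mule_ge0// lee_fin normal_pdf_ge0.
    rewrite mulr1n mule1 muleC lee_wpmul2l// lee_fin std_normal_pdfE.
    rewrite ler_wpM2l ?normal_peak_ge0// ler_expR lerN2 ler_wpM2r ?invr_ge0//.
    move: yJ; rewrite inE /J /= in_itv/= => /andP[y1 y2].
    have y0 : (0 < y)%R by rewrite (le_lt_trans _ y1)// sqrtr_ge0.
    rewrite -[leLHS]real_normK ?num_real// ler_pXn2r ?nnegrE ?addr_ge0 ?sqrtr_ge0//.
    by rewrite (le_trans (ler_normD _ _))// lerD// ger0_norm// ltW.
rewrite -[X in _ <= _ * X]ge0_integral_mrestr//.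
rewrite -[X in _ <= _ * X](@ge0_integral_pushforward _ _ _ _ _ _ msqr (mrestr mu mJ) setT (fun e => h (e + q)%R))//.
rewrite EFinM -muleA lee_wpmul2l ?lee_fin ?(ltW c0)//.
have k0' := ltW k0.
apply: (@le_trans _ _ (\int[mscale (NngNum k0') (mrestr mu mI)]_e h (e + q)%R)); last first.
  apply: ge0_le_measure_integral => // A mA.
  exact: lebesgue_measure_sqr_preimage.
rewrite ge0_integral_mscale//= lee_wpmul2l ?lee_fin// ge0_integral_mrestr//.
rewrite -(@ge0_integral_translation _ (- q)%R (fun e => h (e + q)%R * (\1_I e)%:E)); last 2 first.
- by apply: emeasurable_funM => //; exact/measurable_EFinP.
- by move=> x; rewrite mule_ge0// lee_fin indicE.
rewrite integral_mkcond; apply: ge0_le_integral => //.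
- by move=> x _; rewrite patchE; case: ifP.
- by apply/measurable_restrict => //; exact: measurable_funTS.
- apply: emeasurable_funM; first by under eq_fun do rewrite subrK.
  by apply/measurable_EFinP; exact: measurableT_comp (mshift _).
move=> x _; rewrite patchE subrK; case: ifPn => [|_]; last by rewrite mule_ge0// lee_fin indicE.
rewrite inE/= in_itv/= => /andP[x1 x2].
rewrite indicE mem_set ?mulr1n ?mule1// /I /= in_itv/=.
by move: qQ; rewrite ler_norml => /andP[q1 q2]; rewrite /lo /hi; lra.
Qed.

End normal_minorization.

(** * Rotation invariance of the Gaussian law in the plane *)

Section normal_rotation.
Context {R : realType}.
Local Notation mu := (@lebesgue_measure R).
Local Notation RT := (measurableTypeR R).
Local Notation N := (@normal_prob R 0 1).
Local Notation phi := (@normal_pdf R 0 1).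
Local Open Scope ereal_scope.

Lemma measurable_fun_pairRT (f : RT * RT -> R) (g : RT * RT -> R) :
  measurable_fun setT f -> measurable_fun setT g ->
  measurable_fun setT (fun p => (f p, g p) : RT * RT).
Proof. by move=> mf mg; exact: (@measurable_fun_pair _ _ _ (RT * RT)%type RT RT). Qed.

Let mfst : measurable_fun setT (fun p : RT * RT => p.1 : R).
Proof. exact: (@measurable_fst _ _ RT RT). Qed.

Let msnd : measurable_fun setT (fun p : RT * RT => p.2 : R).
Proof. exact: (@measurable_snd _ _ RT RT). Qed.

Lemma ge0_integral_shear2 (s : R) (f : RT * RT -> \bar R) :
  measurable_fun setT f -> (forall p, 0 <= f p) ->
  \int[mu]_x \int[mu]_y f (x, y + s * x)%R = \int[mu]_x \int[mu]_y f (x, y).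
Proof.
move=> mf f0; apply: eq_integral => x _.
apply: (@ge0_integral_translation _ (s * x)%R (fun y => f (x, y))) => //.
exact: measurable_fun_pair2.
Qed.

Lemma ge0_integral_shear1 (s : R) (f : RT * RT -> \bar R) :
  measurable_fun setT f -> (forall p, 0 <= f p) ->
  \int[mu]_x \int[mu]_y f (x + s * y, y)%R = \int[mu]_x \int[mu]_y f (x, y).
Proof.
move=> mf f0.
rewrite (fubini_tonelli (fun p : RT * RT => f (p.1 + s * p.2, p.2)%R))//=; last first.
  apply: measurableT_comp => //; apply: measurable_fun_pairRT => //.
  by apply: measurable_funD => //; exact: measurable_funM.
rewrite [RHS](fubini_tonelli f)//; apply: eq_integral => y _.
apply: (@ge0_integral_translation _ (s * y)%R (fun x => f (x, y))) => //.
exact: measurable_fun_pair1.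
Qed.

(* A plane rotation is a product of three shears, with [t = tan (theta / 2)]. *)
Lemma ge0_integral_rotation (a b : R) (f : RT * RT -> \bar R) :
  (0 <= a)%R -> (a ^+ 2 + b ^+ 2 = 1)%R ->
  measurable_fun setT f -> (forall p, 0 <= f p) ->
  \int[mu]_x \int[mu]_y f (a * x - b * y, b * x + a * y)%R =
  \int[mu]_x \int[mu]_y f (x, y).
Proof.
move=> a0 ab mf f0; pose t := (b / (1 + a))%R.
have a1 : (1 + a != 0)%R by rewrite gt_eqF// ltr_pwDl.
pose f1 (p : RT * RT) := f (p.1 + (- t) * p.2, p.2)%R.
pose f2 (p : RT * RT) := f1 (p.1, p.2 + b * p.1)%R.
have mf1 : measurable_fun setT f1.
  apply: measurableT_comp => //; apply: measurable_fun_pairRT => //.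
  by apply: measurable_funD => //; exact: measurable_funM.
have mf2 : measurable_fun setT f2.
  apply: (measurableT_comp mf1); apply: measurable_fun_pairRT => //.
  by apply: measurable_funD => //; exact: measurable_funM.
have E := etrans (ge0_integral_shear1 (- t)%R mf2 (fun=> f0 _))
  (etrans (ge0_integral_shear2 b mf1 (fun=> f0 _)) (ge0_integral_shear1 (- t)%R mf f0)).
rewrite -[RHS]E.
apply: eq_integral => x _; apply: eq_integral => y _; rewrite /f2 /f1/=.
have bt : (b * t = 1 - a)%R.
  apply: (mulIf a1); rewrite /t mulrA divfK//.
  by rewrite -expr2; have := ab; lra.
have bt' : (1 - b * t = a)%R by rewrite bt; ring.
have ta : (t * (1 + a) = b)%R by rewrite /t divfK.
congr (f (_, _)).
- have -> : (x + - t * y + - t * (y + b * (x + - t * y)) =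
    (1 - b * t) * x - t * (1 + (1 - b * t)) * y)%R by ring.
  by rewrite bt' ta.
- have -> : (y + b * (x + - t * y) = b * x + (1 - b * t) * y)%R by ring.
  by rewrite bt'.
Qed.

Let ge0_integral_normal2 (f : RT * RT -> \bar R) :
  measurable_fun setT f -> (forall p, 0 <= f p) ->
  \int[N]_x \int[N]_y f (x, y) =
  \int[mu]_x \int[mu]_y (f (x, y) * (phi x * phi y)%:E).
Proof.
move=> mf f0.
have mphi2 : measurable_fun setT (fun p : RT * RT => phi p.2 : R).
  by apply: (measurableT_comp (@measurable_std_normal_pdf R)); exact: measurable_snd.
rewrite ge0_integral_normal; last 2 first.
- exact: measurable_fun_fubini_tonelli_F.
- by move=> x; exact: integral_ge0.
apply: eq_integral => x _.
rewrite ge0_integral_normal//; last exact: measurable_fun_pair2.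
rewrite -ge0_integralZr//.
- by apply: eq_integral => y _; rewrite -muleA -EFinM mulrC.
- apply: emeasurable_funM; first exact: measurable_fun_pair2.
  by apply/measurable_EFinP; exact: measurable_std_normal_pdf.
- by move=> y _; rewrite mule_ge0// lee_fin normal_pdf_ge0.
- by rewrite lee_fin normal_pdf_ge0.
Qed.

Lemma normal_rotation (a b : R) (f : RT * RT -> \bar R) :
  (0 <= a)%R -> (a ^+ 2 + b ^+ 2 = 1)%R ->
  measurable_fun setT f -> (forall p, 0 <= f p) ->
  \int[N]_x \int[N]_y f (a * x - b * y, b * x + a * y)%R =
  \int[N]_x \int[N]_y f (x, y).
Proof.
move=> a0 ab mf f0.
have mphi1 : measurable_fun setT (fun p : RT * RT => phi p.1 : R).
  by apply: (measurableT_comp (@measurable_std_normal_pdf R)); exact: measurable_fst.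
have mphi2 : measurable_fun setT (fun p : RT * RT => phi p.2 : R).
  by apply: (measurableT_comp (@measurable_std_normal_pdf R)); exact: measurable_snd.
pose fr (p : RT * RT) := f (a * p.1 - b * p.2, b * p.1 + a * p.2)%R.
have mfr : measurable_fun setT fr.
  apply: measurableT_comp => //; apply: measurable_fun_pairRT.
  - by apply: measurable_funB; exact: measurable_funM.
  - by apply: measurable_funD; exact: measurable_funM.
pose fg (p : RT * RT) := f p * (phi p.1 * phi p.2)%:E.
have mfg : measurable_fun setT fg.
  by apply: emeasurable_funM => //; apply/measurable_EFinP; exact: measurable_funM.
have fg0 p : 0 <= fg p.
  by rewrite mule_ge0// lee_fin mulr_ge0// normal_pdf_ge0.
have E := etrans (ge0_integral_rotation a0 ab mfg fg0)
  (esym (ge0_integral_normal2 mf f0)).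
apply: (etrans (ge0_integral_normal2 mfr (fun=> f0 _))); apply: etrans E.
apply: eq_integral => x _; apply: eq_integral => y _; rewrite /fg /fr /=.
congr (_ * _%:E).
have phi2 (u w : R) : (phi u * phi w =
    normal_peak 1 * normal_peak 1 * expR (- ((u ^+ 2 + w ^+ 2) / 2)))%R.
  by rewrite !std_normal_pdfE mulrACA -expRD -opprD -mulrDl.
rewrite !phi2; congr (_ * expR (- (_ / 2)))%R.
transitivity ((a ^+ 2 + b ^+ 2) * (x ^+ 2 + y ^+ 2))%R; first by rewrite ab mul1r.
by ring.
Qed.

End normal_rotation.

(** * Nonnegative matrices of order two *)

Lemma det_mx2 {F : comNzRingType} (A : 'M[F]_2) :
  \det A = A 0 0 * A 1 1 - A 0 1 * A 1 0.
Proof.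
rewrite (expand_det_row _ 0) !big_ord_recl big_ord0 /cofactor !det_mx11 !mxE /=.
have -> : lift (0 : 'I_2) 0 = 1 by exact: val_inj.
have -> : lift (1 : 'I_2) 0 = 0 by exact: val_inj.
rewrite /bump/= !addn0 add0n/= expr0 expr1; ring.
Qed.

Lemma root_char_poly2 {F : comNzRingType} (A : 'M[F]_2) (z : F) :
  root (char_poly A) z = ((z - A 0 0) * (z - A 1 1) - A 0 1 * A 1 0 == 0).
Proof.
rewrite /root /char_poly det_mx2 !mxE !hornerE/=.
by congr (_ == 0); ring.
Qed.

Section nonneg_spectral_radius.
Context {R : realType}.
Variable M : 'M[R]_2.
Hypothesis M0 : forall i j, 0 <= M i j.

Let eigen (z : complex.complex R) :=
  root (char_poly (map_mx (fun x : R => complex.Complex x 0) M)) z.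

Let eigenE x y : eigen (complex.Complex x y) =
  ((x - M 0 0) * (x - M 1 1) - y ^+ 2 - M 0 1 * M 1 0 == 0) &&
  (y * (2 * x - M 0 0 - M 1 1) == 0).
Proof.
rewrite /eigen root_char_poly2 !mxE complex.eq_complex /=.
by congr (_ && _); congr (_ == _); ring.
Qed.

(** The discriminant is nonnegative because [M 0 1 * M 1 0] is, so the eigenvalues are real. The
    crude bound is there because [sup] is an upper bound only for a set that has one. *)
Let eigen_le x y : eigen (complex.Complex x y) ->
  y = 0 /\ `|x| <= M 0 0 + M 1 1 + M 0 1 + M 1 0.
Proof.
rewrite eigenE mulf_eq0 => /andP[/eqP re /orP im].
have y0 : y = 0.
  case: im => /eqP im//; apply/eqP; rewrite -sqrf_eq0 eq_le sqr_ge0 andbT.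
  have bc := mulr_ge0 (M0 0 1) (M0 1 0).
  have xE : x = (M 0 0 + M 1 1) / 2 by lra.
  have := sqr_ge0 (M 0 0 - M 1 1).
  have -> : y ^+ 2 = - ((M 0 0 - M 1 1) ^+ 2 / 4) - M 0 1 * M 1 0.
    by have := re; rewrite xE; lra.
  by lra.
split=> //; move: re; rewrite y0 expr0n/= subr0 => re.
have := M0 0 1; have := M0 1 0; have := M0 0 0; have := M0 1 1.
move=> a0 a1 a2 a3; rewrite leNgt; apply/negP; rewrite lter_normr => /orP[x1|x1].
  have : M 0 1 * M 1 0 < (x - M 0 0) * (x - M 1 1).
    by rewrite ltr_pM//; lra.
  by lra.
have : M 0 1 * M 1 0 < (M 0 0 - x) * (M 1 1 - x).
  by rewrite ltr_pM//; lra.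
by lra.
Qed.

(** The larger root [l] of the characteristic polynomial is real and nonnegative, hence below 1. The
    last quantity is the characteristic polynomial at 1, that is, the determinant of [1 - M]. *)
Lemma nonneg_spectral_radius_lt1 : spectral_radius M < 1 ->
  [/\ M 0 0 < 1, M 1 1 < 1 & 0 < (1 - M 0 0) * (1 - M 1 1) - M 0 1 * M 1 0].
Proof.
move=> rho1.
have := M0 0 1; have := M0 1 0; have := M0 0 0; have := M0 1 1 => a0 a1 a2 a3.
have bc := mulr_ge0 a3 a2.
pose disc := (M 0 0 - M 1 1) ^+ 2 + 4 * (M 0 1 * M 1 0).
have disc0 : 0 <= disc by rewrite addr_ge0 ?sqr_ge0// mulr_ge0.
have s2 := sqr_sqrtr disc0.
have s0 := sqrtr_ge0 disc.
set s := Num.sqrt disc in s2 s0.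
pose l := (M 0 0 + M 1 1 + s) / 2.
have l1 : l < 1.
  apply: le_lt_trans rho1; rewrite /spectral_radius; apply: sup_ubound.
    exists (M 0 0 + M 1 1 + M 0 1 + M 1 0) => _ [[x y] /= h <-].
    have [-> xl] := eigen_le h.
    by rewrite /cmod /= expr0n addr0 sqrtr_sqr.
  exists (complex.Complex l 0); last first.
    by rewrite /cmod /= expr0n addr0 sqrtr_sqr ger0_norm// /l; lra.
  rewrite /= -/(eigen _) eigenE mul0r eqxx andbT; apply/eqP.
  transitivity ((s ^+ 2 - disc) / 4); last by rewrite s2 subrr mul0r.
  by rewrite /l /disc; field.
have sl : `|M 0 0 - M 1 1| <= s.
  by rewrite -sqrtr_sqr ler_wsqrtr// /disc lerDl mulr_ge0.
move: sl; rewrite ler_norml => /andP[sl1 sl2].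
have s2l : s < 2 - M 0 0 - M 1 1 by move: l1; rewrite /l; lra.
split; [lra|lra|].
(* The difference of the two squares is four times the determinant of [1 - M]. *)
have : s ^+ 2 < (2 - M 0 0 - M 1 1) ^+ 2 by rewrite ltr_pXn2r// nnegrE//; lra.
rewrite s2 /disc; lra.
Qed.

End nonneg_spectral_radius.

(** * The volatility chain *)

Section noise_operator.
Context {R : realType} {d d1 d2 : measure_display}.
Context {Om : measurableType d} {Y : measurableType d1} {X : measurableType d2}.

Definition noise_op (P : probability Om R) (F : X * Om -> Y) (f : Y -> R)
  (x : X) : R := Rintegral P setT (fun w => f (F (x, w))).

Variables (P : probability Om R) (F : X * Om -> Y).
Hypothesis mF : measurable_fun setT F.

Let mFx x : measurable_fun setT (fun w => F (x, w)).
Proof. exact: measurable_fun_pair2. Qed.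

Let bcomp (f : Y -> R) x : bmeas f -> bmeas (fun w => f (F (x, w))).
Proof.
by move=> [mf [M fM]]; split; [exact: measurableT_comp|exists M => w; exact: fM].
Qed.

Lemma EFin_noise_op f x : bmeas f ->
  (noise_op P F f x)%:E = (\int[P]_w (f (F (x, w)))%:E)%E.
Proof.
move=> bf; rewrite fineK//; apply: integrable_fin_num => //.
exact/bmeas_integrable/bcomp.
Qed.

Lemma markov_noise_op : markov_op (noise_op P F).
Proof.
have mP := mean_Rintegral P; split => [f bf|x]; last first.
  split.
  - by move=> c; exact: (mean_cst mP).
  - by move=> f g bf bg; exact: (meanD mP (bcomp x bf) (bcomp x bg)).
  - by move=> c f bf; exact: (meanZ mP c (bcomp x bf)).
  - by move=> f g bf bg fg; apply: (mean_le mP); [exact: bcomp|exact: bcomp|].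
  - move=> u bu u01 u0.
    by apply: (mean_cvg0 mP) => // n; exact: bcomp.
have [M M0 fM] := bmeas_ub bf; split; last first.
  by exists M => x; apply: (mean_norm_le mP) => //; exact: bcomp.
(* Measurability in [x] comes from Tonelli's theorem for nonnegative integrands, hence the shift by
   the bound of [f]. *)
pose g y := f y + M.
have bg : bmeas g by apply: bmeasD => //; exact: bmeas_cst.
have g0 y : 0 <= g y by have := fM y; rewrite /g ler_norml => /andP[? _]; lra.
have -> : noise_op P F f = (fun x => fine (\int[P]_w (g (F (x, w)))%:E)%E - M).
  apply/funext => x; rewrite /noise_op -[fine _]/(Rintegral P setT (fun w => g (F (x, w)))).
  rewrite (meanD mP (bcomp x bf) (bmeas_cst M)) (mean_cst mP).
  by rewrite addrK.
apply: measurable_funB => //; apply: (measurableT_comp (fine_measurable measurableT)).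
apply: (measurable_fun_fubini_tonelli_F (fun p => (g (F p))%:E)).
  by apply/measurable_EFinP; apply: measurableT_comp => //; have [] := bg.
by move=> p; rewrite lee_fin.
Qed.

End noise_operator.

Lemma measurable_fun_invr {R : realType} {d : measure_display}
    {T : measurableType d} (s : T -> R) :
  measurable_fun setT s -> measurable_fun setT (fun x => (s x)^-1).
Proof.
(* the right-hand side also gives the junk value [0^-1 = 0] *)
move=> ms; rewrite (_ : (fun _ => _) = fun x => s x * expR (- ln (s x ^+ 2))).
  apply: measurable_funM => //; apply: (measurableT_comp (@measurable_expR R)).
  apply: measurable_funN; apply: (measurableT_comp (@measurable_ln R)).
  exact: measurable_funX.
apply/funext => x; have [->|s0] := eqVneq (s x) 0; first by rewrite invr0 mul0r.
by rewrite expRN lnK ?posrE ?exprn_even_gt0// expr2 invfM mulrA divff// mul1r.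
Qed.

Lemma measurable_fun_sqrtr {R : realType} {d : measure_display}
    {T : measurableType d} (s : T -> R) :
  measurable_fun setT s -> measurable_fun setT (fun x => Num.sqrt (s x)).
Proof.
apply: measurableT_comp; apply: continuous_measurable_fun.
exact: sqrt_continuous.
Qed.

Ltac mfun := repeat first
  [ exact: measurable_cst
  | assumption
  | apply: measurable_funD
  | apply: measurable_funN
  | apply: measurable_funM
  | apply: measurable_funX
  | apply: measurable_fun_sqrtr
  | apply: measurable_maxr ].

Section volatility_chain.
Context {R : realType}.
Local Notation RT := (measurableTypeR R).
Local Notation N := (@normal_prob R 0 1).
Variables (r lam o1 o2 b11 b12 b21 b22 a11 a12 a21 a22 g1 g2 : R).
Hypotheses (o1_gt0 : 0 < o1) (o2_gt0 : 0 < o2).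

Definition innov (v : R * R) (e1 e2 : R) : R * R :=
  (o1 + b11 * v.1 + b12 * v.2 + a11 * e1 + a12 * e2,
   o2 + b21 * v.1 + b22 * v.2 + a21 * e1 + a22 * e2).

Definition vol_next (x : R * (R * R)) (u : R) : R * R :=
  let s := x.2.1 + x.2.2 in
  let c := x.1 - r - lam * s in
  innov x.2
    ((Num.sqrt x.2.1 * c / s - Num.sqrt x.2.2 * u / Num.sqrt s
      - g1 * Num.sqrt x.2.1) ^+ 2)
    ((Num.sqrt x.2.2 * c / s + Num.sqrt x.2.1 * u / Num.sqrt s
      - g2 * Num.sqrt x.2.2) ^+ 2).

Definition ret (v : R * R) (z1 z2 : R) : R * (R * R) :=
  (r + lam * (v.1 + v.2) + Num.sqrt v.1 * z1 + Num.sqrt v.2 * z2, v).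

(* Outside the state space the dynamics is extended through this projection,
   so that all estimates hold without side conditions. *)
Definition clamp (v : R * R) : R * R := (Num.max v.1 o1, Num.max v.2 o2).

Definition vol_map (p : (R * (R * R)) * RT) : R * R :=
  vol_next (p.1.1, clamp p.1.2) p.2.

Definition ret_map (p : (R * R) * RT * RT) : R * (R * R) :=
  ret (clamp p.1.1) p.1.2 p.2.

Definition vol_op := noise_op N vol_map.

(** The outer operator, driven by the identity map, merely records the first normal variable next to
    the volatility; two independent draws thus become a composition of one-noise operators. *)
Definition ret_op (g : R * (R * R) -> R) : R * R -> R :=
  noise_op N (fun p : (R * R) * RT => p) (noise_op N ret_map g).

Lemma clampK v : clamp (clamp v) = clamp v.
Proof. by rewrite /clamp /= -!maxA !maxxx. Qed.

Let v1_gt0 v : 0 < (clamp v).1.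
Proof. by rewrite /clamp/= lt_max o1_gt0 orbT. Qed.
Let v2_gt0 v : 0 < (clamp v).2.
Proof. by rewrite /clamp/= lt_max o2_gt0 orbT. Qed.
Let s_gt0 v : 0 < (clamp v).1 + (clamp v).2.
Proof. exact: addr_gt0. Qed.

Lemma measurable_vol_next :
  measurable_fun setT (fun p : (R * (R * R)) * RT => vol_next p.1 p.2).
Proof.
have m1 : measurable_fun setT (fun p : (R * (R * R)) * RT => p.1.1).
  exact: (measurableT_comp measurable_fst measurable_fst).
have m2 : measurable_fun setT (fun p : (R * (R * R)) * RT => p.2 : R).
  exact: (@measurable_snd _ _ _ RT).
have m12 : measurable_fun setT (fun p : (R * (R * R)) * RT => p.1.2).
  exact: (measurableT_comp measurable_snd measurable_fst).
have mv1 : measurable_fun setT (fun p : (R * (R * R)) * RT => p.1.2.1).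
  exact: (measurableT_comp measurable_fst m12).
have mv2 : measurable_fun setT (fun p : (R * (R * R)) * RT => p.1.2.2).
  exact: (measurableT_comp measurable_snd m12).
have ms : measurable_fun setT (fun p : (R * (R * R)) * RT => (p.1.2.1 + p.1.2.2)^-1).
  by apply: measurable_fun_invr => //; mfun.
have mss : measurable_fun setT
    (fun p : (R * (R * R)) * RT => (Num.sqrt (p.1.2.1 + p.1.2.2))^-1).
  by apply: measurable_fun_invr; mfun.
by apply: measurable_fun_pair; rewrite /=; mfun.
Qed.

Lemma measurable_ret :
  measurable_fun setT (fun p : (R * R) * RT * RT => ret p.1.1 p.1.2 p.2).
Proof.
have m2 : measurable_fun setT (fun p : (R * R) * RT * RT => p.2 : R).
  exact: (@measurable_snd _ _ _ RT).
have m12 : measurable_fun setT (fun p : (R * R) * RT * RT => p.1.2 : R).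
  exact: (measurableT_comp (@measurable_snd _ _ (R * R)%type RT)
    (@measurable_fst _ _ ((R * R) * RT)%type RT)).
have m11 : measurable_fun setT (fun p : (R * R) * RT * RT => p.1.1).
  exact: (measurableT_comp measurable_fst measurable_fst).
have mv1 : measurable_fun setT (fun p : (R * R) * RT * RT => p.1.1.1).
  exact: (measurableT_comp measurable_fst m11).
have mv2 : measurable_fun setT (fun p : (R * R) * RT * RT => p.1.1.2).
  exact: (measurableT_comp measurable_snd m11).
by apply: measurable_fun_pair => //=; mfun.
Qed.

Lemma measurable_clamp : measurable_fun setT clamp.
Proof. by apply: measurable_fun_pair; apply: measurable_maxr. Qed.

Lemma measurable_vol_map : measurable_fun setT vol_map.
Proof.
have mc : measurable_fun setT
    (fun p : (R * (R * R)) * RT => ((p.1.1, clamp p.1.2), p.2) : (R * (R * R)) * RT).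
  apply: measurable_fun_pair; last exact: (@measurable_snd _ _ _ RT).
  apply: measurable_fun_pair; first exact: (measurableT_comp measurable_fst measurable_fst).
  apply: (measurableT_comp measurable_clamp).
  exact: (measurableT_comp measurable_snd measurable_fst).
exact: (measurableT_comp measurable_vol_next mc).
Qed.

Lemma measurable_ret_map : measurable_fun setT ret_map.
Proof.
have mc : measurable_fun setT
    (fun p : (R * R) * RT * RT => ((clamp p.1.1, p.1.2), p.2) : (R * R) * RT * RT).
  apply: measurable_fun_pair; last exact: (@measurable_snd _ _ _ RT).
  apply: measurable_fun_pair; last first.
    exact: (measurableT_comp (@measurable_snd _ _ (R * R)%type RT)
      (@measurable_fst _ _ ((R * R) * RT)%type RT)).
  apply: (measurableT_comp measurable_clamp).
  exact: (measurableT_comp measurable_fst measurable_fst).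
exact: (measurableT_comp measurable_ret mc).
Qed.

Lemma markov_vol_op : markov_op vol_op.
Proof. by apply: markov_noise_op; exact: measurable_vol_map. Qed.

Lemma markov_ret_op : markov_op ret_op.
Proof.
apply: markov_op_comp; first exact: markov_noise_op.
by apply: markov_noise_op; exact: measurable_ret_map.
Qed.

Local Open Scope ereal_scope.

Lemma EFin_ret_op g v : bmeas g ->
  (ret_op g v)%:E = \int[N]_z1 \int[N]_z2 (g (ret_map (v, z1, z2)))%:E.
Proof.
move=> bg; have mN : markov_op (noise_op N ret_map).
  by apply: markov_noise_op; exact: measurable_ret_map.
rewrite EFin_noise_op//; last exact: mN.1.
apply: eq_integral => z1 _; rewrite EFin_noise_op//.
exact: measurable_ret_map.
Qed.

(** The recursion of the model with both normal variables free; in [vol_next] they are tied by the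
    observed return. *)
Definition vol_noise (v : R * R) (z : R * R) : R * R :=
  innov (clamp v) ((z.1 - g1 * Num.sqrt (clamp v).1) ^+ 2)%R
    ((z.2 - g2 * Num.sqrt (clamp v).2) ^+ 2)%R.

Lemma measurable_vol_noise v : measurable_fun setT (fun z : RT * RT => vol_noise v z).
Proof.
have m1 : measurable_fun setT (fun p : RT * RT => p.1 : R).
  exact: (@measurable_fst _ _ RT RT).
have m2 : measurable_fun setT (fun p : RT * RT => p.2 : R).
  exact: (@measurable_snd _ _ RT RT).
by apply: measurable_fun_pair => /=; mfun.
Qed.

(** With [(a, b)] the unit vector along the square roots of the volatilities, the centred return
    divided by [Num.sqrt s] is [y = a * z1 + b * z2], and [K] rebuilds the noise as
    [(a * y - b * u, b * y + a * u)]. One rotation makes [y] a standard normal variable independent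
    of [u]; a second one turns [(y, u)] into two free normal variables. *)
Lemma EFin_vol_chain f v : bmeas f -> (forall y, 0 <= f y)%R ->
  (ret_op (vol_op f) v)%:E = \int[N]_x \int[N]_y (f (vol_noise v (x, y)))%:E.
Proof.
move=> bf f0; rewrite EFin_ret_op; last exact: markov_vol_op.1.
set s := ((clamp v).1 + (clamp v).2)%R.
pose a := (Num.sqrt (clamp v).1 / Num.sqrt s)%R.
pose b := (Num.sqrt (clamp v).2 / Num.sqrt s)%R.
have ss0 : (0 < Num.sqrt s)%R by rewrite sqrtr_gt0; exact: s_gt0.
have a0 : (0 <= a)%R by rewrite divr_ge0 ?sqrtr_ge0.
have ab : (a ^+ 2 + b ^+ 2 = 1)%R.
  rewrite /a /b !expr_div_n (sqr_sqrtr (ltW (s_gt0 v))).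
  rewrite (sqr_sqrtr (ltW (v1_gt0 v))) (sqr_sqrtr (ltW (v2_gt0 v))).
  by rewrite -mulrDl divff// gt_eqF//; exact: s_gt0.
have abN : (a ^+ 2 + (- b) ^+ 2 = 1)%R by rewrite sqrrN.
pose h (z : RT * RT) := (f (vol_noise v z))%:E.
have mh : measurable_fun setT h.
  apply/measurable_EFinP; apply: measurableT_comp (measurable_vol_noise v).
  by have [] := bf.
have h0 z : 0 <= h z by rewrite lee_fin.
have mrot : measurable_fun setT
    (fun p : RT * RT => h (a * p.1 - b * p.2, b * p.1 + a * p.2)%R).
  have m1 : measurable_fun setT (fun p : RT * RT => p.1 : R).
    exact: (@measurable_fst _ _ RT RT).
  have m2 : measurable_fun setT (fun p : RT * RT => p.2 : R).
    exact: (@measurable_snd _ _ RT RT).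
  by apply: (measurableT_comp mh); apply: measurable_fun_pairRT; mfun.
pose Phi y := \int[N]_u h (a * y - b * u, b * y + a * u)%R.
have mPhi : measurable_fun setT (Phi : RT -> \bar R).
  exact: (measurable_fun_fubini_tonelli_F (fun p : RT * RT => h (a * p.1 - b * p.2, b * p.1 + a * p.2)%R)).
have Phi0 y : 0 <= Phi y by exact: integral_ge0.
transitivity (\int[N]_z1 \int[N]_z2 Phi (a * z1 - (- b) * z2)%R).
  apply: eq_integral => z1 _; apply: eq_integral => z2 _.
  rewrite EFin_noise_op//; last exact: measurable_vol_map.
  apply: eq_integral => u _; congr (f _)%:E.
  rewrite /vol_map /ret_map /ret /= clampK /vol_next /vol_noise /= -/s.
  have sE : s = (Num.sqrt s ^+ 2)%R by rewrite sqr_sqrtr// ltW//; exact: s_gt0.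
  rewrite /a /b; set q := Num.sqrt s in ss0 sE *.
  by congr (innov _ (_ ^+ 2) (_ ^+ 2))%R; rewrite sE; field; rewrite gt_eqF.
(* The integrand sees only the first rotated coordinate; the second integrates to 1. *)
rewrite (normal_rotation (f := fun p : RT * RT => Phi p.1) a0 abN)//; last first.
  exact: (measurableT_comp mPhi (@measurable_fst _ _ RT RT)).
apply: etrans (normal_rotation a0 ab mh h0); apply: eq_integral => x _.
have := integral_cst N measurableT (Phi x) => /= ->.
by rewrite [X in _ * X](_ : _ = 1) ?mule1//; exact: probability_setT.
Qed.

End volatility_chain.

Section normal_quadratic.
Context {R : realType}.
Local Notation RT := (measurableTypeR R).
Local Notation N := (@normal_prob R 0 1).
Local Open Scope ereal_scope.

Let msqr : measurable_fun setT (fun x : RT => (x : R) ^+ 2)%R.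
Proof. exact: (@measurable_funX _ RT). Qed.

Lemma measurable_quadratic (a b : R) :
  measurable_fun setT (fun x : RT => (a + b * (x : R) ^+ 2)%:E).
Proof.
by apply/measurable_EFinP; apply: measurable_funD => //; exact: measurable_funM.
Qed.

(** Kept symbolic, as the drift asks only for a finite constant; [normal_second_moment] guarantees
    that [fine] loses nothing. *)
Definition normal_m2 : R := fine (\int[N]_x ((x : R) ^+ 2)%:E).

Lemma normal_m2_ge0 : (0 <= normal_m2)%R.
Proof. by apply: fine_ge0; apply: integral_ge0 => x _; rewrite lee_fin sqr_ge0. Qed.

Lemma normal_quadratic (A c : R) : (0 <= A)%R -> (0 <= c)%R ->
  \int[N]_x (A + c * (x : R) ^+ 2)%:E = (A + c * normal_m2)%:E.
Proof.
move=> A0 c0.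
have mx2 : measurable_fun setT (fun x : RT => ((x : R) ^+ 2)%:E).
  exact/measurable_EFinP.
transitivity (\int[N]_x (A%:E + c%:E * ((x : R) ^+ 2)%:E)).
  by apply: eq_integral => x _; rewrite -EFinM -EFinD.
rewrite ge0_integralD//; last 2 first.
- by move=> x _; rewrite mule_ge0 ?lee_fin ?sqr_ge0.
- exact: emeasurable_funM.
rewrite ge0_integralZl//; last by move=> x _; rewrite lee_fin sqr_ge0.
have := integral_cst N measurableT A%:E => /= ->.
rewrite [X in _ * X + _](_ : _ = 1) ?mule1; last exact: probability_setT.
rewrite EFinD EFinM /normal_m2 fineK// ge0_fin_numE ?normal_second_moment//.
by apply: integral_ge0 => x _; rewrite lee_fin sqr_ge0.
Qed.

Lemma normal_quadratic2 (f : RT * RT -> R) (A c1 c2 : R) :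
  (0 <= A)%R -> (0 <= c1)%R -> (0 <= c2)%R ->
  measurable_fun setT f -> (forall z, 0 <= f z)%R ->
  (forall x y : R, f (x, y) <= A + c1 * x ^+ 2 + c2 * y ^+ 2)%R ->
  \int[N]_x \int[N]_y (f (x, y))%:E <= (A + c1 * normal_m2 + c2 * normal_m2)%:E.
Proof.
move=> A0 c10 c20 mf f0 fA.
have mEf : measurable_fun setT (fun z : RT * RT => (f z)%:E) by exact/measurable_EFinP.
have cm2 := mulr_ge0 c20 normal_m2_ge0.
have mx2 := measurable_quadratic.
have -> : (A + c1 * normal_m2 + c2 * normal_m2 = (A + c2 * normal_m2) + c1 * normal_m2)%R.
  by ring.
rewrite -normal_quadratic ?addr_ge0//; apply: ge0_le_integral => //.
- by move=> x _; apply: integral_ge0 => y _; rewrite lee_fin.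
- exact: (measurable_fun_fubini_tonelli_F (fun z : RT * RT => (f z)%:E)).
move=> x _; rewrite (_ : (A + _ + _ = (A + c1 * (x : R) ^+ 2) + c2 * normal_m2)%R); last by ring.
have Ax : (0 <= A + c1 * (x : R) ^+ 2)%R by apply: addr_ge0 => //; apply: mulr_ge0 => //; exact: sqr_ge0.
rewrite -normal_quadratic//; apply: ge0_le_integral => //.
- by move=> y _; rewrite lee_fin.
- exact: (measurable_fun_pair2 x mEf).
- by move=> y _; rewrite lee_fin.
Qed.

End normal_quadratic.

(** * Drift of the volatility chain and the weight on returns *)

Section lyapunov.
Context {R : realType}.
Local Notation RT := (measurableTypeR R).
Local Notation N := (@normal_prob R 0 1).
Variables (r lam o1 o2 b11 b12 b21 b22 a11 a12 a21 a22 g1 g2 : R).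
Hypotheses (o1_gt0 : 0 < o1) (o2_gt0 : 0 < o2).
Hypotheses (b11_ge0 : 0 <= b11) (b12_ge0 : 0 <= b12).
Hypotheses (b21_ge0 : 0 <= b21) (b22_ge0 : 0 <= b22).
Hypotheses (a11_ge0 : 0 <= a11) (a12_ge0 : 0 <= a12).
Hypotheses (a21_ge0 : 0 <= a21) (a22_ge0 : 0 <= a22).
Let M11 := b11 + a11 * g1 ^+ 2.
Let M12 := b12 + a12 * g2 ^+ 2.
Let M21 := b21 + a21 * g1 ^+ 2.
Let M22 := b22 + a22 * g2 ^+ 2.
Let del := (1 - M11) * (1 - M22) - M12 * M21.
Hypotheses (M11_lt1 : M11 < 1) (M22_lt1 : M22 < 1) (del_gt0 : 0 < del).

Local Notation innov := (innov o1 o2 b11 b12 b21 b22 a11 a12 a21 a22).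
Local Notation clamp := (clamp o1 o2).
Local Notation vol_map := (vol_map r lam o1 o2 b11 b12 b21 b22 a11 a12 a21 a22 g1 g2).
Local Notation vol_op := (vol_op r lam o1 o2 b11 b12 b21 b22 a11 a12 a21 a22 g1 g2).
Local Notation ret_map := (ret_map r lam o1 o2).
Local Notation ret_op := (ret_op r lam o1 o2).
Local Notation vol_noise := (vol_noise o1 o2 b11 b12 b21 b22 a11 a12 a21 a22 g1 g2).

(* The weights [p1, p2] are the column sums of the adjugate of [1 - B], so that
   [p^T B = p^T - det (1 - B) * (1, 1)]. *)
Let p1 := (1 - M22) + M21.
Let p2 := (1 - M11) + M12.
Let q1 := p1 * a11 + p2 * a21.
Let q2 := p1 * a12 + p2 * a22.
Let po := p1 * o1 + p2 * o2.

Definition lyapunov (v : R * R) : R :=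
  p1 * (clamp v).1 + p2 * (clamp v).2.
Local Notation V := lyapunov.

Let M12_ge0 : 0 <= M12. Proof. by rewrite addr_ge0// mulr_ge0// sqr_ge0. Qed.
Let M21_ge0 : 0 <= M21. Proof. by rewrite addr_ge0// mulr_ge0// sqr_ge0. Qed.
Let M22_ge0 : 0 <= M22. Proof. by rewrite addr_ge0// mulr_ge0// sqr_ge0. Qed.
Let p1_gt0 : 0 < p1. Proof. by rewrite ltr_wpDr// subr_gt0. Qed.
Let p2_gt0 : 0 < p2. Proof. by rewrite ltr_wpDr// subr_gt0. Qed.
Let q1_ge0 : 0 <= q1. Proof. by rewrite addr_ge0// mulr_ge0// ltW. Qed.
Let q2_ge0 : 0 <= q2. Proof. by rewrite addr_ge0// mulr_ge0// ltW. Qed.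
Let po_gt0 : 0 < po. Proof. by rewrite addr_gt0// mulr_gt0. Qed.
Let v1_gt0 v : 0 < (clamp v).1. Proof. by rewrite /= lt_max o1_gt0 orbT. Qed.
Let v2_gt0 v : 0 < (clamp v).2. Proof. by rewrite /= lt_max o2_gt0 orbT. Qed.

Lemma lyapunov_gt0 v : 0 < V v.
Proof. by rewrite addr_gt0// mulr_gt0. Qed.

Lemma lyapunov_sublevel (L : R) : exists2 B, 0 <= B &
  forall v, V v <= L -> (clamp v).1 <= B /\ (clamp v).2 <= B.
Proof.
exists (`|L| / p1 + `|L| / p2).
  by rewrite addr_ge0// divr_ge0// ltW.
move=> v VL; have L1 : 0 <= `|L| / p1 by rewrite divr_ge0// ltW.
have L2 : 0 <= `|L| / p2 by rewrite divr_ge0// ltW.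
have := mulr_gt0 p1_gt0 (v1_gt0 v); have := mulr_gt0 p2_gt0 (v2_gt0 v) => h2 h1.
have := ler_norm L; move: VL; rewrite /lyapunov => VL LL.
split; [apply: (@le_trans _ _ (`|L| / p1))|apply: (@le_trans _ _ (`|L| / p2))].
- by rewrite ler_pdivlMr// mulrC; lra.
- by rewrite lerDl.
- by rewrite ler_pdivlMr// mulrC; lra.
- by rewrite lerDr.
Qed.

Lemma measurable_lyapunov : measurable_fun setT V.
Proof.
by apply: measurable_funD; apply: measurable_funM => //; apply: measurable_maxr.
Qed.

Lemma clamp_innov v e1 e2 : 0 <= v.1 -> 0 <= v.2 -> 0 <= e1 -> 0 <= e2 ->
  clamp (innov v e1 e2) = innov v e1 e2.
Proof.
move=> v1 v2 e10 e20; rewrite /clamp /innov /=; congr (_, _); apply/max_idPl;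
  by rewrite -!addrA lerDl !addr_ge0// mulr_ge0.
Qed.

(** The squares are compared with [g^2 v], the part of them that [B] accounts for: this part gives
    [p^T B = p^T - del * (1, 1)], and the deviations enter with the weights [q = p^T alpha]. *)
Lemma lyapunov_innov v e1 e2 : 0 <= e1 -> 0 <= e2 ->
  V (innov (clamp v) e1 e2) = po + (p1 - del) * (clamp v).1
    + (p2 - del) * (clamp v).2 + q1 * (e1 - g1 ^+ 2 * (clamp v).1)
    + q2 * (e2 - g2 ^+ 2 * (clamp v).2).
Proof.
move=> e10 e20; rewrite /lyapunov clamp_innov ?(ltW (v1_gt0 _)) ?(ltW (v2_gt0 _))//.
rewrite /innov; set v1 := (clamp v).1; set v2 := (clamp v).2.
rewrite /po /q1 /q2 /p1 /p2 /del /M11 /M12 /M21 /M22 /=; ring.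
Qed.

Let k1 := q1 * g1 ^+ 2.
Let k2 := q2 * g2 ^+ 2.
(** Young parameter, small enough that the errors [eps * k1] and [eps * k2] cost at most half of the
    gain [del]; the 1 keeps the denominator positive. *)
Let eps := del / (2 * (1 + k1 + k2)).
Let k1_ge0 : 0 <= k1. Proof. by rewrite mulr_ge0// sqr_ge0. Qed.
Let k2_ge0 : 0 <= k2. Proof. by rewrite mulr_ge0// sqr_ge0. Qed.
Let k_gt0 : 0 < 1 + k1 + k2.
Proof. by move: k1_ge0 k2_ge0; lra. Qed.
Let eps_gt0 : 0 < eps. Proof. by rewrite divr_gt0// mulr_gt0. Qed.
Let epsE : eps * (1 + k1 + k2) = del / 2.
Proof. by rewrite /eps; field; move: k_gt0 => /gt_eqF ->. Qed.

(** The gain left after Young's inequality is [del / 2] times the sum of the volatilities, and [V]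
    is at most [p1 + p2] times that sum. *)
Definition drift_rate := 1 - del / (2 * (p1 + p2)).
Definition drift_cst := po + (1 + eps^-1) * (q1 + q2) * normal_m2.

Lemma drift_rate01 : 0 < drift_rate < 1.
Proof.
have dp : del <= p2.
  rewrite /del /p2; have := mulr_ge0 M12_ge0 M21_ge0.
  have : (1 - M11) * (1 - M22) <= 1 - M11 by rewrite ler_piMr//; move: M11_lt1 M22_ge0; lra.
  by move: M12_ge0; lra.
have p0 : 0 < 2 * (p1 + p2) by rewrite mulr_gt0// addr_gt0.
rewrite /drift_rate subr_gt0 ltr_pdivrMr// mul1r gtrDl oppr_lt0 divr_gt0// andbT.
by move: p1_gt0 p2_gt0; lra.
Qed.

Lemma drift_cst_gt0 : 0 < drift_cst.
Proof.
have e0 : 0 <= eps^-1 by rewrite invr_ge0 ltW.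
rewrite /drift_cst; apply: ltr_wpDr => //.
by apply: mulr_ge0; [apply: mulr_ge0; exact: addr_ge0|exact: normal_m2_ge0].
Qed.

(** The cross term [- 2 m z], with [m = g * Num.sqrt v], is absorbed pointwise instead of being
    integrated to 0, so that only nonnegative quadratic integrands occur. *)
Let young (z g v : R) : 0 < v ->
  (z - g * Num.sqrt v) ^+ 2 - g ^+ 2 * v <= eps * (g ^+ 2 * v) + (1 + eps^-1) * z ^+ 2.
Proof.
move=> v0; rewrite -{2 3}(sqr_sqrtr (ltW v0)); set m := g * Num.sqrt v.
have -> : g ^+ 2 * Num.sqrt v ^+ 2 = m ^+ 2 by rewrite -exprMn.
suff : 0 <= (eps * m + z) ^+ 2 / eps.
  have -> : (eps * m + z) ^+ 2 / eps = eps * m ^+ 2 + 2 * m * z + eps^-1 * z ^+ 2.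
    by field; move: eps_gt0 => /gt_eqF ->.
  by lra.
by rewrite divr_ge0 ?sqr_ge0// ltW.
Qed.

Let lyapunov_noise_le v x y : V (vol_noise v (x, y)) <=
  drift_rate * V v + po + (1 + eps^-1) * q1 * x ^+ 2 + (1 + eps^-1) * q2 * y ^+ 2.
Proof.
rewrite /vol_noise lyapunov_innov ?sqr_ge0//= -/(clamp v).
have := ler_wpM2l q1_ge0 (young x g1 (v1_gt0 v)).
have := ler_wpM2l q2_ge0 (young y g2 (v2_gt0 v)).
have v1 := v1_gt0 v; have v2 := v2_gt0 v.
rewrite /lyapunov; set w1 := (clamp v).1 in v1 *; set w2 := (clamp v).2 in v2 *.
rewrite -[Num.max v.1 o1]/w1 -[Num.max v.2 o2]/w2 => h2 h1.
have e1 : eps * k1 * w1 <= del / 2 * w1.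
  by rewrite ler_wpM2r ?(ltW v1)// -epsE ler_wpM2l ?(ltW eps_gt0)//; move: k1_ge0 k2_ge0; lra.
have e2 : eps * k2 * w2 <= del / 2 * w2.
  by rewrite ler_wpM2r ?(ltW v2)// -epsE ler_wpM2l ?(ltW eps_gt0)//; move: k1_ge0 k2_ge0; lra.
have p0 : 0 < p1 + p2 by rewrite addr_gt0.
have h3 : drift_rate * (p1 * w1 + p2 * w2) >= p1 * w1 + p2 * w2 - del / 2 * (w1 + w2).
  suff : del / (2 * (p1 + p2)) * (p1 * w1 + p2 * w2) <= del / 2 * (w1 + w2).
    by rewrite /drift_rate; lra.
  have -> : del / (2 * (p1 + p2)) * (p1 * w1 + p2 * w2) =
      del / 2 * ((p1 * w1 + p2 * w2) / (p1 + p2)) by field; rewrite gt_eqF.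
  rewrite ler_wpM2l ?divr_ge0 ?(ltW del_gt0)// ler_pdivrMr//.
  by have := mulr_ge0 (ltW p1_gt0) (ltW v2); have := mulr_ge0 (ltW p2_gt0) (ltW v1); lra.
move: e1 e2 h1 h2 h3; rewrite /k1 /k2; lra.
Qed.

Lemma lyapunov_drift v : mean_ub (fun f => ret_op (vol_op f) v) V (drift_rate * V v + drift_cst).
Proof.
move=> M M0; have V0 y := ltW (lyapunov_gt0 y).
have bVM := bmeas_trunc measurable_lyapunov V0 M0.
have VM0 y : 0 <= Num.min (V y) M by rewrite le_min V0.
have c0 : 0 <= 1 + eps^-1 by rewrite addr_ge0// invr_ge0 ltW.
rewrite -lee_fin EFin_vol_chain//.
have mf : measurable_fun setT (fun z : RT * RT => Num.min (V (vol_noise v z)) M).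
  by apply: (measurableT_comp bVM.1); exact: measurable_vol_noise.
have [/ltW d0 _] := andP drift_rate01.
apply: (le_trans (normal_quadratic2 (A := drift_rate * V v + po) (c1 := (1 + eps^-1) * q1)
  (c2 := (1 + eps^-1) * q2) _ _ _ mf _ _)).
- by rewrite addr_ge0 ?(ltW po_gt0)// mulr_ge0.
- exact: mulr_ge0.
- exact: mulr_ge0.
- by move=> z.
- by move=> x y; rewrite ge_min lyapunov_noise_le.
- by rewrite lee_fin /drift_cst; lra.
Qed.


(** An upper bound for the conditional mean of [V v_{t+1}] given [x]: the squared norm of the
    rebuilt noise is [c^2 / s + u^2], where [c] is the centred return. *)
Definition ret_weight (x : R * (R * R)) : R :=
  let s := (clamp x.2).1 + (clamp x.2).2 in
  po + 2 * V x.2 + 2 * (q1 + q2) * ((x.1 - r - lam * s) ^+ 2 / s + normal_m2).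
Local Notation W := ret_weight.

Let s_gt0 v : 0 < (clamp v).1 + (clamp v).2. Proof. exact: addr_gt0. Qed.
Let qs_ge0 : 0 <= q1 + q2. Proof. exact: addr_ge0. Qed.
Let V_ge0 v : 0 <= V v. Proof. by rewrite ltW// lyapunov_gt0. Qed.

Let qsq_ge0 (c v : R) : 0 < v -> 0 <= 2 * (q1 + q2) * (c ^+ 2 / v).
Proof. by move=> v0; rewrite mulr_ge0 ?divr_ge0 ?sqr_ge0 ?(ltW v0)// mulr_ge0. Qed.

Let qm2_ge0 : 0 <= 2 * (q1 + q2) * normal_m2.
Proof. by apply: mulr_ge0; [exact: mulr_ge0|exact: normal_m2_ge0]. Qed.

Lemma ret_weight_ge0 x : 0 <= W x.
Proof.
have := qsq_ge0 (x.1 - r - lam * ((clamp x.2).1 + (clamp x.2).2)) (s_gt0 x.2).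
have := qm2_ge0; have := po_gt0; have := V_ge0 x.2.
by rewrite /ret_weight mulrDr; lra.
Qed.

Lemma measurable_ret_weight : measurable_fun setT W.
Proof.
have m1 : measurable_fun setT (fun x : R * (R * R) => x.1) by exact: measurable_fst.
have mV : measurable_fun setT (fun x : R * (R * R) => V x.2).
  exact: (measurableT_comp measurable_lyapunov measurable_snd).
have ms : measurable_fun setT (fun x : R * (R * R) => (clamp x.2).1 + (clamp x.2).2).
  by apply: measurable_funD; apply: measurable_maxr => //=;
    [exact: (measurableT_comp measurable_fst measurable_snd)
    |exact: (measurableT_comp measurable_snd measurable_snd)].
have ms' := measurable_fun_invr ms.
by rewrite /ret_weight; mfun.
Qed.

Let k1_le : k1 <= p1.
Proof.
have -> : k1 = p1 - del - (p1 * b11 + p2 * b21).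
  by rewrite /k1 /q1 /p1 /p2 /del /M11 /M12 /M21 /M22; ring.
have := mulr_ge0 (ltW p1_gt0) b11_ge0; have := mulr_ge0 (ltW p2_gt0) b21_ge0.
by move: del_gt0; lra.
Qed.

Let k2_le : k2 <= p2.
Proof.
have -> : k2 = p2 - del - (p1 * b12 + p2 * b22).
  by rewrite /k2 /q2 /p1 /p2 /del /M11 /M12 /M21 /M22; ring.
have := mulr_ge0 (ltW p1_gt0) b12_ge0; have := mulr_ge0 (ltW p2_gt0) b22_ge0.
by move: del_gt0; lra.
Qed.

(** Amounts to [(z - m)^2 <= 2 z^2 + 2 m^2]. Doubling is harmless here, since no contraction is
    asked of [K] alone. *)
Let sqr_le (z g v : R) : 0 < v ->
  (z - g * Num.sqrt v) ^+ 2 - g ^+ 2 * v <= 2 * z ^+ 2 + g ^+ 2 * v.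
Proof.
move=> v0; rewrite -{2 3}(sqr_sqrtr (ltW v0)).
by have := sqr_ge0 (z + g * Num.sqrt v); lra.
Qed.

Let lyapunov_vol_map_le x (u : R) : V (vol_map (x, u)) <=
  po + 2 * V x.2 + 2 * (q1 + q2) * ((x.1 - r - lam * ((clamp x.2).1 + (clamp x.2).2)) ^+ 2 /
    ((clamp x.2).1 + (clamp x.2).2)) + 2 * (q1 + q2) * u ^+ 2.
Proof.
have w1_gt0 := v1_gt0 x.2; have w2_gt0 := v2_gt0 x.2; have w_gt0 := s_gt0 x.2.
pose w1 := (clamp x.2).1; pose w2 := (clamp x.2).2; pose s := w1 + w2.
pose c := x.1 - r - lam * s.
pose z1 := Num.sqrt w1 * c / s - Num.sqrt w2 * u / Num.sqrt s.
pose z2 := Num.sqrt w2 * c / s + Num.sqrt w1 * u / Num.sqrt s.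
(* [c / Num.sqrt s] and [u] are the coordinates of [(z1, z2)] in an orthonormal basis. *)
have zE : z1 ^+ 2 + z2 ^+ 2 = c ^+ 2 / s + u ^+ 2.
  rewrite /z1 /z2.
  have s0 : 0 < Num.sqrt s by rewrite sqrtr_gt0.
  have sE : s = Num.sqrt s ^+ 2 by rewrite sqr_sqrtr// ltW.
  have wE : Num.sqrt w1 ^+ 2 + Num.sqrt w2 ^+ 2 = s by rewrite !sqr_sqrtr// ltW.
  move: s0 sE wE; set q := Num.sqrt s; set y1 := Num.sqrt w1; set y2 := Num.sqrt w2.
  move=> s0 -> wE.
  transitivity ((y1 ^+ 2 + y2 ^+ 2) / q ^+ 2 * (c ^+ 2 / q ^+ 2 + u ^+ 2)).
    by field; rewrite gt_eqF.
  by rewrite wE; field; rewrite gt_eqF.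
rewrite -[vol_map (x, u)]/(innov (clamp x.2) ((z1 - g1 * Num.sqrt w1) ^+ 2)
  ((z2 - g2 * Num.sqrt w2) ^+ 2)).
rewrite lyapunov_innov ?sqr_ge0// -/w1 -/w2 -/s -/c.
have h1 := ler_wpM2l q1_ge0 (sqr_le z1 g1 w1_gt0).
have h2 := ler_wpM2l q2_ge0 (sqr_le z2 g2 w2_gt0).
have h3 := ler_wpM2r (ltW w1_gt0) k1_le.
have h4 := ler_wpM2r (ltW w2_gt0) k2_le.
have h5 := mulr_ge0 (ltW del_gt0) (ltW w1_gt0).
have h6 := mulr_ge0 (ltW del_gt0) (ltW w2_gt0).
have h7 := mulr_ge0 q1_ge0 (sqr_ge0 z2).
have h8 := mulr_ge0 q2_ge0 (sqr_ge0 z1).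
have h9 : 2 * (q1 + q2) * (z1 ^+ 2 + z2 ^+ 2) =
  2 * (q1 + q2) * (c ^+ 2 / s) + 2 * (q1 + q2) * u ^+ 2 by rewrite zE mulrDr.
rewrite -[_ + 2 * (q1 + q2) * (c ^+ 2 / s) + _]addrA -h9 /lyapunov.
move: h1 h2 h3 h4 h5 h6; rewrite -/w1 -/w2 /k1 /k2; lra.
Qed.

Lemma ret_weight_vol_op x : mean_ub (fun f => vol_op f x) V (W x).
Proof.
move=> M M0; have bVM := bmeas_trunc measurable_lyapunov V_ge0 M0.
have mvol := measurable_vol_map r lam o1 o2 b11 b12 b21 b22 a11 a12 a21 a22 g1 g2.
rewrite -lee_fin EFin_noise_op//.
set s := (clamp x.2).1 + (clamp x.2).2; pose c := x.1 - r - lam * s.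
have -> : W x = (po + 2 * V x.2 + 2 * (q1 + q2) * (c ^+ 2 / s)) + (2 * (q1 + q2)) * normal_m2.
  by rewrite /ret_weight -/s -/c; ring.
have A0 : 0 <= po + 2 * V x.2 + 2 * (q1 + q2) * (c ^+ 2 / s).
  have := qsq_ge0 c (s_gt0 x.2); have := po_gt0; have := V_ge0 x.2.
  by rewrite -/s; lra.
have c0 : 0 <= 2 * (q1 + q2) by rewrite mulr_ge0.
rewrite -normal_quadratic//; apply: ge0_le_integral => //.
- by move=> u _; rewrite lee_fin le_min V_ge0.
- apply/measurable_EFinP; apply: (measurableT_comp bVM.1).
  exact: (measurable_fun_pair2 x mvol).
- exact: measurable_quadratic.
- by move=> u _; rewrite lee_fin ge_min lyapunov_vol_map_le.
Qed.

(** The 6 adds up three terms [2 * (q1 + q2) * normal_m2], one from [W] itself and one from each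
    normal variable; the final 2 covers the [2 * V] in [W]. *)
Definition ret_weight_cst := po + 6 * (q1 + q2) * normal_m2 + 2.

Lemma ret_weight_cst_ge0 : 0 <= ret_weight_cst.
Proof. by have := qm2_ge0; have := po_gt0; rewrite /ret_weight_cst; lra. Qed.

Lemma ret_weight_ret_op v :
  mean_ub (fun g => ret_op g v) W (ret_weight_cst + ret_weight_cst * V v).
Proof.
move=> M M0; have bWM := bmeas_trunc measurable_ret_weight ret_weight_ge0 M0.
have mret := measurable_ret_map r lam o1 o2.
rewrite -lee_fin EFin_ret_op//.
have c0 : 0 <= 2 * (q1 + q2) by rewrite mulr_ge0.
have mf : measurable_fun setT (fun z : RT * RT => Num.min (W (ret_map (v, z.1, z.2))) M).
  have mz : measurable_fun setT (fun z : RT * RT => (v, z.1, z.2) : (R * R) * RT * RT).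
    apply: measurable_fun_pair; last exact: (@measurable_snd _ _ RT RT).
    by apply: measurable_fun_pair => //; exact: (@measurable_fst _ _ RT RT).
  exact: (measurableT_comp bWM.1 (measurableT_comp mret mz)).
apply: (le_trans (normal_quadratic2 (A := po + 2 * V v + 2 * (q1 + q2) * normal_m2)
  (c1 := 2 * (q1 + q2)) (c2 := 2 * (q1 + q2)) _ c0 c0 mf _ _)).
- by have := po_gt0; have := V_ge0 v; have := qm2_ge0; lra.
- by move=> z; rewrite le_min ret_weight_ge0.
- move=> x y; rewrite ge_min; apply/orP; left.
  rewrite -[W _]/(po + 2 * V (clamp v) + 2 * (q1 + q2) *
    ((r + lam * ((clamp v).1 + (clamp v).2) + Num.sqrt (clamp v).1 * x
      + Num.sqrt (clamp v).2 * y - r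
      - lam * ((clamp (clamp v)).1 + (clamp (clamp v)).2)) ^+ 2 /
      ((clamp (clamp v)).1 + (clamp (clamp v)).2) + normal_m2)) clampK.
  have -> : V (clamp v) = V v by rewrite /lyapunov clampK.
  have s0 := s_gt0 v; have w1_gt0 := v1_gt0 v; have w2_gt0 := v2_gt0 v.
  set w1 := (clamp v).1 in w1_gt0 s0 *; set w2 := (clamp v).2 in w2_gt0 s0 *.
  (* Centring removes [r] and [lam]; what remains is the Cauchy-Schwarz inequality. *)
  suff H : (r + lam * (w1 + w2) + Num.sqrt w1 * x + Num.sqrt w2 * y - r - lam * (w1 + w2)) ^+ 2
      / (w1 + w2) <= x ^+ 2 + y ^+ 2.
    by have := ler_wpM2l c0 H; lra.
  rewrite ler_pdivrMr//.
  move: (sqr_sqrtr (ltW w1_gt0)) (sqr_sqrtr (ltW w2_gt0)).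
  set y1 := Num.sqrt w1; set y2 := Num.sqrt w2 => <- <-.
  by have := sqr_ge0 (y1 * y - y2 * x); lra.
rewrite lee_fin /ret_weight_cst.
have : 0 <= (po + 6 * (q1 + q2) * normal_m2) * V v.
  by rewrite mulr_ge0//; have := po_gt0; have := qm2_ge0; lra.
lra.
Qed.

End lyapunov.

(** * Minorization of the volatility chain *)

Section minorization.
Context {R : realType}.
Local Notation RT := (measurableTypeR R).
Local Notation N := (@normal_prob R 0 1).
Variables (r lam o1 o2 b11 b12 b21 b22 a11 a12 a21 a22 g1 g2 : R).
Hypotheses (o1_gt0 : 0 < o1) (o2_gt0 : 0 < o2).
Hypothesis det_neq0 : a11 * a22 - a12 * a21 != 0.

Local Notation clamp := (clamp o1 o2).
Local Notation vol_op := (vol_op r lam o1 o2 b11 b12 b21 b22 a11 a12 a21 a22 g1 g2).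
Local Notation ret_op := (ret_op r lam o1 o2).
Local Notation vol_noise := (vol_noise o1 o2 b11 b12 b21 b22 a11 a12 a21 a22 g1 g2).

Let lin (e : RT * RT) : R * R := (a11 * e.1 + a12 * e.2, a21 * e.1 + a22 * e.2).

Let measurable_lin : measurable_fun setT lin.
Proof.
have m1 : measurable_fun setT (fun p : RT * RT => p.1 : R).
  exact: (@measurable_fst _ _ RT RT).
have m2 : measurable_fun setT (fun p : RT * RT => p.2 : R).
  exact: (@measurable_snd _ _ RT RT).
by apply: measurable_fun_pair => /=; mfun.
Qed.

(* With [e = (z - m)^2] the new volatility is [alpha (e + q)] where
   [alpha q = omega + beta v], and [q] stays bounded on bounded sets. *)
Lemma vol_minorization (B : R) : 0 <= B ->
  exists (al : R) (nu : (R * R -> R) -> R), [/\ 0 < al < 1, mean nu &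
    forall v, (clamp v).1 <= B -> (clamp v).2 <= B ->
    forall f, bmeas f -> (forall y, 0 <= f y) ->
      al * nu f <= ret_op (vol_op f) v].
Proof.
move=> B0.
pose det := a11 * a22 - a12 * a21.
(* For volatilities bounded by [B], these bound the shifts [m], the vector [t = omega + beta v] and,
   by Cramer's rule, the solution [q] of [alpha q = t]. *)
pose Mb := (`|g1| + `|g2|) * Num.sqrt B.
pose tb := `|o1| + `|o2| + (`|b11| + `|b12| + `|b21| + `|b22|) * B.
pose Qb := (`|a11| + `|a12| + `|a21| + `|a22|) * tb / `|det|.
have tb0 : 0 <= tb by rewrite !addr_ge0// mulr_ge0// !addr_ge0.
have Mb0 : 0 <= Mb by rewrite mulr_ge0 ?addr_ge0 ?sqrtr_ge0.
have Qb0 : 0 <= Qb by rewrite divr_ge0// mulr_ge0// !addr_ge0.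
have [k k0 minor] := normal_sqr_minorization Mb0 Qb0.
have ab : Qb + 1 < Qb + 2 by lra.
(* The interval has length 1, so that the uniform density equals 1. *)
pose U := uniform_prob ab.
have UE (h : RT -> \bar R) : measurable_fun setT h -> (forall x, 0 <= h x)%E ->
    (\int[U]_e h e = \int[lebesgue_measure]_(e in `[(Qb + 1)%R, (Qb + 2)%R]) h e)%E.
  move=> mh h0; rewrite integral_uniform//.
  by rewrite (_ : (Qb + 2 - (Qb + 1))^-1 = 1) ?mul1e//; rewrite -[RHS]invr1; congr _^-1; ring.
(* The image under [alpha] of the uniform law on a square, written as a chain started from [tt] so
   that it is a mean by composition. *)
pose nu (f : R * R -> R) := noise_op U (fun p : unit * RT => p.2) (noise_op U lin f) tt.
have mU1 : markov_op (noise_op U lin) by exact: markov_noise_op.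
have mnu : mean nu.
  have [_ +] := markov_op_comp (markov_noise_op U (@measurable_snd _ _ unit RT)) mU1.
  by move=> /(_ tt).
have nuE f : bmeas f -> (nu f)%:E = (\int[U]_e1 \int[U]_e2 (f (lin (e1, e2)))%:E)%E.
  move=> bf; rewrite EFin_noise_op; [|exact: measurable_snd|exact: mU1.1].
  by apply: eq_integral => e1 _; rewrite EFin_noise_op.
(* The minimum only serves to keep [al] below 1. *)
pose al := Num.min (k * k) (1 / 2).
exists al, nu; split => //.
  rewrite /al lt_min mulr_gt0//= gt_min; apply/andP; split; first by lra.
  by apply/orP; right; lra.
move=> v v1B v2B f bf f0.
have w1_gt0 : 0 < (clamp v).1 by rewrite /= lt_max o1_gt0 orbT.
have w2_gt0 : 0 < (clamp v).2 by rewrite /= lt_max o2_gt0 orbT.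
have nuf0 : 0 <= nu f by exact: mean_ge0 mnu bf f0.
apply: (@le_trans _ _ (k * k * nu f)).
  by rewrite ler_wpM2r// /al ge_min lexx.
rewrite -lee_fin EFin_vol_chain// EFinM nuE//.
pose h (e : RT * RT) := (f (lin e))%:E.
have mh : measurable_fun setT h.
  by apply/measurable_EFinP; exact: (measurableT_comp bf.1 measurable_lin).
have h0 e : (0 <= h e)%E by rewrite lee_fin.
pose w1 := (clamp v).1; pose w2 := (clamp v).2.
pose t1 := o1 + b11 * w1 + b12 * w2; pose t2 := o2 + b21 * w1 + b22 * w2.
pose q1 := (a22 * t1 - a12 * t2) / det; pose q2 := (a11 * t2 - a21 * t1) / det.
pose m1 := g1 * Num.sqrt w1; pose m2 := g2 * Num.sqrt w2.
have wB (w : R) : 0 < w -> w <= B -> `|w| <= B by move=> ? ?; rewrite gtr0_norm.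
have bwB (b w : R) : 0 < w -> w <= B -> `|b * w| <= `|b| * B.
  by move=> w0 wb; rewrite normrM ler_wpM2l// wB.
have mB (g w c : R) : 0 < w -> w <= B -> `|g| <= c -> `|g * Num.sqrt w| <= c * Num.sqrt B.
  move=> w0 wb gc; rewrite normrM (ger0_norm (sqrtr_ge0 w)).
  by rewrite ler_pM// ler_wsqrtr.
have m1M : `|m1| <= Mb by apply: mB => //; rewrite lerDl.
have m2M : `|m2| <= Mb by apply: mB => //; rewrite lerDr.
have t1B : `|t1| <= tb.
  have := bwB b11 _ w1_gt0 v1B; have := bwB b12 _ w2_gt0 v2B => h2 h1.
  have := ler_normD (o1 + b11 * w1) (b12 * w2); have := ler_normD o1 (b11 * w1).
  have := normr_ge0 o2; have := mulr_ge0 (normr_ge0 b21) B0; have := mulr_ge0 (normr_ge0 b22) B0.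
  by rewrite /t1 /tb; move: h1 h2; rewrite -/w1 -/w2; lra.
have t2B : `|t2| <= tb.
  have := bwB b21 _ w1_gt0 v1B; have := bwB b22 _ w2_gt0 v2B => h2 h1.
  have := ler_normD (o2 + b21 * w1) (b22 * w2); have := ler_normD o2 (b21 * w1).
  have := normr_ge0 o1; have := mulr_ge0 (normr_ge0 b11) B0; have := mulr_ge0 (normr_ge0 b12) B0.
  by rewrite /t2 /tb; move: h1 h2; rewrite -/w1 -/w2; lra.
have qB (x y c d : R) : `|x| <= tb -> `|y| <= tb ->
    `|c| + `|d| <= `|a11| + `|a12| + `|a21| + `|a22| -> `|(c * x - d * y) / det| <= Qb.
  move=> xb yb cd; rewrite normrM normfV ler_wpM2r ?invr_ge0//.
  apply: (le_trans (ler_normB _ _)); rewrite !normrM.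
  apply: (@le_trans _ _ ((`|c| + `|d|) * tb)); last by rewrite ler_wpM2r.
  by rewrite mulrDl lerD// ler_wpM2l.
have q1Q : `|q1| <= Qb.
  by apply: qB => //; have := normr_ge0 a11; have := normr_ge0 a21; lra.
have q2Q : `|q2| <= Qb.
  by apply: qB => //; have := normr_ge0 a12; have := normr_ge0 a22; lra.
have noiseE x y : vol_noise v (x, y) = lin ((x - m1) ^+ 2 + q1, (y - m2) ^+ 2 + q2).
  have e1 : a11 * q1 + a12 * q2 = t1 by rewrite /q1 /q2 /det; field.
  have e2 : a21 * q1 + a22 * q2 = t2 by rewrite /q1 /q2 /det; field.
  rewrite /vol_noise /innov /lin; congr (_, _); rewrite -/w1 -/w2 -/m1 -/m2 /=.
    by rewrite -/w1 -/w2 -/m1 -/m2 !mulrDr addrACA e1 /t1 addrC !addrA.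
  by rewrite -/w1 -/w2 -/m1 -/m2 !mulrDr addrACA e2 /t2 addrC !addrA.
(* The one-variable minorization is applied to the second coordinate with the first frozen, then to
   the first coordinate of the result: hence the factor [k * k]. *)
pose Psi (e1 : RT) := (k%:E * \int[U]_e2 h (e1, e2))%E.
have mPsi0 : measurable_fun setT (fun e1 : RT => \int[U]_e2 h (e1, e2))%E.
  exact: (measurable_fun_fubini_tonelli_F h).
have mPsi : measurable_fun setT Psi by exact: emeasurable_funM.
have Psi0' e1 : (0 <= \int[U]_e2 h (e1, e2))%E by exact: integral_ge0.
have Psi0 e1 : (0 <= Psi e1)%E by rewrite mule_ge0// lee_fin ltW.
have inner x : (Psi ((x - m1) ^+ 2 + q1)%R <= \int[N]_y h ((x - m1) ^+ 2 + q1, (y - m2) ^+ 2 + q2)%R)%E.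
  rewrite /Psi UE//; last exact: (measurable_fun_pair2 _ mh).
  by apply: (minor m2 q2 m2M q2Q (fun e => h ((x - m1) ^+ 2 + q1, e)%R)) => //;
    exact: (measurable_fun_pair2 _ mh).
apply: (@le_trans _ _ (\int[N]_x Psi ((x - m1) ^+ 2 + q1)%R)%E).
  rewrite EFinM -muleA -ge0_integralZl ?lee_fin ?(ltW k0)//.
    by rewrite UE//; exact: minor.
  by move=> e1 _; exact: Psi0'.
have msq (m q : R) : measurable_fun setT (fun x : RT => (x - m) ^+ 2 + q : R).
  exact: (@measurable_funD _ RT _ _ _ _ (@measurable_funX _ RT _ _ _ 2
    (@measurable_funB _ RT _ _ _ _ (@measurable_id_R R) (measurable_cst m)))
    (measurable_cst q)).
apply: ge0_le_integral => //.
- exact: (measurableT_comp mPsi (msq m1 q1)).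
- apply: (measurable_fun_fubini_tonelli_F (fun z : RT * RT => (f (vol_noise v z))%:E)).
    by apply/measurable_EFinP; apply: (measurableT_comp bf.1); exact: measurable_vol_noise.
  by move=> z; rewrite lee_fin.
move=> x _; apply: (le_trans (inner x)).
by rewrite le_eqVlt; apply/orP; left; apply/eqP; apply: eq_integral => y _; rewrite noiseE.
Qed.

End minorization.

(** * Geometric ergodicity *)

Section garch.
Context {R : realType}.
Local Notation RT := (measurableTypeR R).
Local Notation N := (@normal_prob R 0 1).
Variables (r lam : R) (omega : 'I_2 -> R) (beta alpha : 'M[R]_2) (gamma : 'I_2 -> R).
Hypothesis A1 : assumption1 omega beta alpha.

Let i1 : 'I_2 := ord0.
Let i2 : 'I_2 := lift ord0 ord0.
Let step := garch_step r lam omega beta alpha gamma.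
Let S := statespace omega.
Let o1 := omega i1.
Let o2 := omega i2.
Let proj := clamp o1 o2.
Let vnext := vol_next r lam o1 o2 (beta i1 i1) (beta i1 i2) (beta i2 i1) (beta i2 i2)
  (alpha i1 i1) (alpha i1 i2) (alpha i2 i1) (alpha i2 i2) (gamma i1) (gamma i2).
Let rt := ret r lam.

Let stepE x w : step x w = rt (vnext x w.1) w.2.1 w.2.2.
Proof. by []. Qed.

(** [K0] and [H0] are the factors of the given transition, without projection; they describe [step]
    at every point but agree with [K] and [H] only from the state space. *)
Let K0 := noise_op N (fun p : state * RT => vnext p.1 p.2).
Let H0 (g : state -> R) := noise_op N (fun p : (R * R) * RT => p)
  (noise_op N (fun p : (R * R) * RT * RT => rt p.1.1 p.1.2 p.2) g).
Let K := vol_op r lam o1 o2 (beta i1 i1) (beta i1 i2) (beta i2 i1) (beta i2 i2)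
  (alpha i1 i1) (alpha i1 i2) (alpha i2 i1) (alpha i2 i2) (gamma i1) (gamma i2).
Let H := ret_op r lam o1 o2.

Let mrt : markov_op (noise_op N (fun p : (R * R) * RT * RT => rt p.1.1 p.1.2 p.2)).
Proof. by apply: markov_noise_op; exact: measurable_ret. Qed.

Let mH0 : markov_op H0.
Proof. by apply: markov_op_comp mrt; exact: markov_noise_op. Qed.

Let mK0 : markov_op K0.
Proof. by apply: markov_noise_op; exact: measurable_vol_next. Qed.

Let Enoise_step g x : bmeas g -> Enoise (fun w => g (step x w)) = K0 (H0 g) x.
Proof.
move=> bg; apply: EFin_inj; rewrite /K0 EFin_noise_op; last 2 first.
- exact: measurable_vol_next.
- exact: mH0.1.
have E : (\int[N]_u \int[N]_z1 \int[N]_z2 (g (step x (u, (z1, z2))))%:E =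
    \int[N]_u (H0 g (vnext x u))%:E)%E.
  apply: eq_integral => u _; rewrite EFin_noise_op//; last exact: mrt.1.
  apply: eq_integral => z1 _; rewrite EFin_noise_op//.
  exact: measurable_ret.
rewrite /Enoise /stdN E fineK//; apply: integrable_fin_num => //.
apply: bmeas_integrable; have [mHg [M HM]] := mH0.1 _ bg; split.
  apply: (measurableT_comp mHg).
  exact: (measurable_fun_pair2 x (@measurable_vol_next R _ _ _ _ _ _ _ _ _ _ _ _ _ _)).
by exists M => u.
Qed.

Let omega_gt0 i : 0 < omega i. Proof. by have [] := A1. Qed.
Let beta_ge0 i j : 0 <= beta i j. Proof. by have [_ []] := A1. Qed.
Let alpha_ge0 i j : 0 <= alpha i j. Proof. by have [_ [_ []]] := A1. Qed.

Let proj_id v : o1 <= v.1 -> o2 <= v.2 -> proj v = v.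
Proof.
move=> v1 v2; rewrite /proj /clamp (max_idPl v1) (max_idPl v2).
by case: v {v1 v2}.
Qed.

Let S_vnext x u : S x -> o1 <= (vnext x u).1 /\ o2 <= (vnext x u).2.
Proof.
move=> [x1 x2]; have x10 := le_trans (ltW (omega_gt0 _)) x1.
have x20 := le_trans (ltW (omega_gt0 _)) x2.
by split; rewrite /= -!addrA lerDl !addr_ge0// mulr_ge0 ?sqr_ge0.
Qed.

Let S_step x w : S x -> S (step x w).
Proof. by move=> Sx; rewrite stepE; exact: S_vnext. Qed.

Let KH_S g x : S x -> K0 (H0 g) x = K (H g) x.
Proof.
move=> Sx; apply: eq_Rintegral => u _.
have -> : vol_map r lam o1 o2 (beta i1 i1) (beta i1 i2) (beta i2 i1) (beta i2 i2)
  (alpha i1 i1) (alpha i1 i2) (alpha i2 i1) (alpha i2 i2) (gamma i1) (gamma i2) (x, u) =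
    vnext x u.
  rewrite /vol_map /= -/proj -/vnext; have [x1 x2] := Sx.
  by rewrite proj_id//; congr vnext; case: x {Sx x1 x2}.
have [v1 v2] := S_vnext u Sx.
apply: eq_Rintegral => z1 _; apply: eq_Rintegral => z2 _.
by rewrite /ret_map /= -/proj proj_id.
Qed.

Let PnE n g x : S x -> bmeas g -> Pn step n g x = iter n (fun h => K (H h)) g x.
Proof.
move=> + bg; elim: n x => [//|n IH] x Sx /=.
have mKH : markov_op (fun h => K (H h)).
  by apply: markov_op_comp; [exact: markov_vol_op|exact: markov_ret_op].
rewrite -KH_S// -Enoise_step; last by have [+ _] := markov_op_iter n mKH; exact.
congr Enoise; apply/funext => w; apply: IH; exact: S_step.
Qed.

Let measurable_S : measurable S.
Proof.
have mS (f : state -> R) c : measurable_fun setT f -> measurable [set x | c <= f x].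
  by move=> mf; rewrite -[X in measurable X]setTI; apply: measurable_fun_ler.
apply: measurableI; apply: mS.
  exact: (measurableT_comp measurable_fst measurable_snd).
exact: (measurableT_comp measurable_snd measurable_snd).
Qed.

(** Because of the projection, every draw of [H] lies in the state space; invariance then forces the
    limit law to charge nothing else. *)
Let H_indicS : H (\1_S) = fun=> 1.
Proof.
have E : noise_op N (ret_map r lam o1 o2) (\1_S) = fun=> 1.
  apply/funext => p; rewrite -[RHS](mean_cst (mean_Rintegral N) 1).
  apply: eq_Rintegral => z _; rewrite indicE mem_set//.
  by split; rewrite /= le_max lexx orbT.
by rewrite /H /ret_op E; apply/funext => v; exact: (mean_cst (mean_Rintegral N)).
Qed.

Theorem garch_ergodic : spectral_radius (Bmat beta alpha gamma) < 1 ->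
  \det alpha != 0 ->
  exists pi : probability state R,
    geometrically_ergodic step S pi /\ pi_invariant step pi.
Proof.
move=> rhoB detA.
have [] := nonneg_spectral_radius_lt1 _ rhoB.
  by move=> i j; rewrite mxE addr_ge0// mulr_ge0// sqr_ge0.
have -> : (0 : 'I_2) = i1 by exact: val_inj.
have -> : (1 : 'I_2) = i2 by exact: val_inj.
rewrite !mxE => B11 B22 delta.
have det0 : alpha i1 i1 * alpha i2 i2 - alpha i1 i2 * alpha i2 i1 != 0.
  move: detA; rewrite det_mx2.
  have -> : (0 : 'I_2) = i1 by exact: val_inj.
  by have -> : (1 : 'I_2) = i2 by exact: val_inj.
pose V := lyapunov o1 o2 (beta i1 i1) (beta i1 i2) (beta i2 i1) (beta i2 i2)
  (alpha i1 i1) (alpha i1 i2) (alpha i2 i1) (alpha i2 i2) (gamma i1) (gamma i2).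
pose gam := drift_rate (beta i1 i1) (beta i1 i2) (beta i2 i1) (beta i2 i2)
  (alpha i1 i1) (alpha i1 i2) (alpha i2 i1) (alpha i2 i2) (gamma i1) (gamma i2).
pose C := drift_cst o1 o2 (beta i1 i1) (beta i1 i2) (beta i2 i1) (beta i2 i2)
  (alpha i1 i1) (alpha i1 i2) (alpha i2 i1) (alpha i2 i2) (gamma i1) (gamma i2).
pose W := ret_weight r lam o1 o2 (beta i1 i1) (beta i1 i2) (beta i2 i1) (beta i2 i2)
  (alpha i1 i1) (alpha i1 i2) (alpha i2 i1) (alpha i2 i2) (gamma i1) (gamma i2).
pose D := ret_weight_cst o1 o2 (beta i1 i1) (beta i1 i2) (beta i2 i1) (beta i2 i2)
  (alpha i1 i1) (alpha i1 i2) (alpha i2 i1) (alpha i2 i2) (gamma i1) (gamma i2).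
have o1_gt0 : 0 < o1 := omega_gt0 _.
have o2_gt0 : 0 < o2 := omega_gt0 _.
have mK : markov_op K by exact: markov_vol_op.
have mH : markov_op H by exact: markov_ret_op.
have V0 v : 0 <= V v by apply: ltW; apply: lyapunov_gt0.
have W0 x : 0 <= W x by apply: ret_weight_ge0.
have gam01 : 0 < gam < 1 by apply: drift_rate01.
have C0 : 0 < C by apply: drift_cst_gt0.
have D0 : 0 <= D by apply: ret_weight_cst_ge0.
have mV : measurable_fun setT V by exact: measurable_lyapunov.
have mW : measurable_fun setT W by exact: measurable_ret_weight.
have drift v : mean_ub (fun f => H (K f) v) V (gam * V v + C) by apply: lyapunov_drift.
have KV x : mean_ub (fun f => K f x) V (W x) by apply: ret_weight_vol_op.
have HW v : mean_ub (fun g => H g v) W (D + D * V v) by apply: ret_weight_ret_op.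
have [B B0 VB] : exists2 B, 0 <= B & forall v, V v <= 4 * C / (1 - gam) ->
    (proj v).1 <= B /\ (proj v).2 <= B by apply: lyapunov_sublevel.
have [al [nu [al01 mnu minor]]] := @vol_minorization R r lam o1 o2
  (beta i1 i1) (beta i1 i2) (beta i2 i1) (beta i2 i2) (alpha i1 i1) (alpha i1 i2)
  (alpha i2 i1) (alpha i2 i2) (gamma i1) (gamma i2) o1_gt0 o2_gt0 det0 B B0.
have {}minor v : V v <= 4 * C / (1 - gam) ->
    forall f, bmeas f -> (forall y, 0 <= f y) -> al * nu f <= H (K f) v.
  by move=> /VB[v1 v2]; exact: minor.
have [pi [c [Q [c01 [mQ Q0] iQ rate inv]]]] :=
  harris_ergodic mK mH mnu mV V0 mW W0 gam01 C0 al01 D0 drift minor KV HW.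
have piS : pi S = 1%E.
  rewrite -[LHS]fineK ?fin_num_measure//; congr EFin.
  transitivity (Rintegral pi setT (\1_S : state -> R)).
    by rewrite /Rintegral integral_indic// setIT.
  rewrite -inv; last exact: bmeas_indic.
  rewrite H_indicS (_ : K _ = fun=> 1); first exact: (mean_cst (mean_Rintegral pi)).
  by apply/funext => x; exact: (mean_cst (mK.2 x)).
have bm1 (g : @state R -> R) : measurable_fun setT g -> (forall y, `|g y| <= 1) -> bmeas g.
  by move=> mg g1; split => //; exists 1.
exists pi; split.
  split => //; exists c, Q; split => //; split => //; split => //; split => //.
  move=> n x Sx; apply: ge_sup.
    (* [ge_sup] requires a nonempty set. *)
    by exists `|Pn step n (fun=> 0) x - pint pi (fun=> 0)|, (fun=> 0) => //; split => // y; rewrite normr0.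
  move=> _ [g [mg g1] <-]; rewrite PnE//; last exact: bm1.
  by apply: rate => //; exact: bm1.
move=> g mg g1; have bg := bm1 _ mg g1; rewrite -[RHS]inv//.
(* Invariance is known for the projected chain, which agrees with the given one only on the state
   space; this has full measure, so the integrands agree almost everywhere. *)
congr fine; apply: ae_eq_integral => //.
- apply/measurable_EFinP; rewrite (_ : Pn _ _ _ = K0 (H0 g)).
    by have [] := mK0.1 _ (mH0.1 _ bg).
  by apply/funext => x; exact: Enoise_step.
- by apply/measurable_EFinP; have [] := mK.1 _ (mH.1 _ bg).
- exists (~` S); split; first exact: measurableC.
    by apply: etrans (probability_setC pi measurable_S) _; rewrite piS subee.
  move=> x /= nx Sx; apply: nx => _; congr EFin.
  by rewrite -KH_S//; exact: Enoise_step.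
Qed.

End garch.

Theorem theorem1 (R : realType) (r lam : R) (omega : 'I_2 -> R)
    (beta alpha : 'M[R]_2) (gamma : 'I_2 -> R) :
  assumption1 omega beta alpha ->
  spectral_radius (Bmat beta alpha gamma) < 1 ->
  spectral_radius beta < 1 ->
  \det alpha != 0 ->
  (varphi beta alpha gamma < 1%:E)%E ->
  exists pi : probability state R,
    geometrically_ergodic (garch_step r lam omega beta alpha gamma)
      (statespace omega) pi /\
    pi_invariant (garch_step r lam omega beta alpha gamma) pi.
Proof. by move=> A1 rhoB _ detA _; exact: garch_ergodic. Qed.
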